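(* Let $M$ be a closed Riemannian manifold of dimension $n$, and let $\beta = \operatorname{rk} H_1(M;\mathbb{Z}/2)$ be its first $\mathbb{Z}/2$-Betti number. If every unit ball $B\subset M$ satisfies $\mathrm{UW}_1(B) < 1/15$, then $\mathrm{UW}_1(M) < \beta + 1$.
   Context: The Urysohn $d$-width of a compact metric space $X$ is $$\mathrm{UW}_d(X) = \inf_{\pi: X\to Y}\ \sup_{y\in Y}\ \operatorname{diam}(\pi^{-1}(y)),$$ where the infimum is over all continuous maps $\pi$ from $X$ to any simplicial complex $Y$ of dimension at most $d$, and $\operatorname{diam} A = \sup_{a,a'\in A}\operatorname{dist}_X(a,a')$. The width of a closed subset $S\subset X$ is defined using the extrinsic metric: diameters of subsets of $S$ are measured with $\operatorname{dist}_X$. A Riemannian manifold is regarded as a metric space with its Riemannian distance. Unit balls are the closed metric balls of radius $1$ in $M$. Closed manifold means compact without boundary. *)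

(* Defs.v *)
From HB Require Import structures.
From mathcomp Require Import all_boot all_order all_algebra.
From mathcomp Require Import finmap freeg.
From mathcomp Require Import all_classical all_reals all_analysis.
Import Order.TTheory GRing.Theory Num.Theory.
Import numFieldNormedType.Exports.

Set Implicit Arguments.
Unset Strict Implicit.
Unset Printing Implicit Defensive.

Local Open Scope classical_set_scope.
Local Open Scope ring_scope.

(* Elements of [V] that lie in no face are not vertices of the complex, so the
   empty complex and any vertex set contained in [V] are covered. *)
Record simplicial_complex (V : choiceType) := SimplicialComplex {
  faces : set {fset V};
  faces_neq0 : forall s, faces s -> s != fset0;
  faces_sub : forall s t, faces s -> (t `<=` s)%fset -> t != fset0 -> faces t
}.

Definition dim_le (V : choiceType) (d : nat) (K : simplicial_complex V) :=
  forall s, faces K s -> (#|` s| <= d.+1)%N.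

(* The closed simplex spanned by [s], in barycentric coordinates. *)
Definition simplex_of (R : realType) (V : choiceType) (s : {fset V})
    : set (V -> R) :=
  [set x | [/\ forall v, 0 <= x v, forall v, v \notin s -> x v = 0
             & \sum_(v <- s) x v = 1]].

Record realization (R : realType) (V : choiceType)
    (K : simplicial_complex V) := Realization {
  barycentric :> V -> R;
  barycentricP : exists2 s, faces K s & simplex_of s barycentric
}.

Section realization_topology.
Variables (R : realType) (V : choiceType) (K : simplicial_complex V).
Local Notation X := (realization R K).

HB.instance Definition _ := gen_eqMixin X.
HB.instance Definition _ := gen_choiceMixin X.

(* The weak (coherent) topology: a set is open iff its trace on each closed
   simplex is relatively open for the Euclidean topology of the simplex, which
   is the one induced by the product topology of [V -> R]. *)
Definition realization_open : set_system X :=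
  [set U | forall s, faces K s -> exists2 O : set {ptws V -> R}, open O &
    forall x : X, simplex_of s x -> (U x <-> O (x : V -> R))].

Lemma realization_openT : realization_open setT.
Proof. by move=> s _; exists setT => //; exact: openT. Qed.

Lemma realization_openI : setI_closed realization_open.
Proof.
move=> A B oA oB s Ks; have [OA oOA hA] := oA s Ks; have [OB oOB hB] := oB s Ks.
exists (OA `&` OB); first exact: openI.
move=> x sx; have [hA1 hA2] := hA x sx; have [hB1 hB2] := hB x sx.
by split=> -[a b]; split; auto.
Qed.

Lemma realization_open_bigU (I : Type) (f : I -> set X) :
  (forall i, realization_open (f i)) -> realization_open (\bigcup_i f i).
Proof.
move=> fo s Ks; have /choice[W hW] : forall i, exists O : set {ptws V -> R},
    open O /\ forall x : X, simplex_of s x -> (f i x <-> O (x : V -> R)).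
  by move=> i; have [W ? ?] := fo i s Ks; exists W.
exists (\bigcup_i W i); first by apply: bigcup_open => i _; case: (hW i).
move=> x sx; split=> -[i _ h]; exists i => //;
  by case: (hW i) => _ /(_ x sx) [h1 h2]; auto.
Qed.

HB.instance Definition _ := @isOpenTopological.Build X realization_open
  realization_openT realization_openI realization_open_bigU.

End realization_topology.

Section urysohn_width.
Local Open Scope ereal_scope.
Variables (R : realType) (T : topologicalType) (dist : T -> T -> \bar R).

Definition diam (A : set T) : \bar R :=
  ereal_sup [set e | exists a b, [/\ A a, A b & e = dist a b]].

(* [UW d S] is the [d]-width of the subset [S], for the extrinsic metric. Only
   the restriction of [f] to [S] matters, and [{within S, continuous f}] is the
   continuity of that restriction for the subspace topology. *)
Definition UW (d : nat) (S : set T) : \bar R :=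
  ereal_inf [set w | exists (V : choiceType) (K : simplicial_complex V)
      (f : T -> realization R K),
    [/\ dim_le d K, {within S, continuous f} &
        w = ereal_sup [set diam (S `&` f @^-1` [set y]) | y in setT]]].

End urysohn_width.

(* [Ck k U f]: for [U] open, [f] has partial derivatives up to order [k] on [U],
   all of them continuous on [U]. *)
Fixpoint Ck (R : realType) (n k : nat) (U : set 'rV[R]_n) (f : 'rV[R]_n -> R)
    : Prop :=
  (forall x, U x -> {for x, continuous f}) /\
  if k is k'.+1 then
    forall j : 'I_n, (forall x, U x -> derivable f x (delta_mx 0 j)) /\
      Ck k' U ('D_(delta_mx 0 j) f)
  else True.

Definition smooth (R : realType) (n : nat) (U : set 'rV[R]_n)
    (f : 'rV[R]_n -> R) :=
  forall k, Ck k U f.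

(* A manifold is given by an atlas; [chart i] and [chart_inv i] are only
   meaningful on [dom i] and on [chart i @` dom i]. [metric i x] is the Gram
   matrix of the Riemannian metric in the coordinate frame of the chart [i].
   Tangent vectors are row vectors: with [f := chart j \o chart_inv i], the
   coordinate vector [v] in the chart [i] becomes [v *m 'J f p] in the chart
   [j]. *)
Record riemannian_manifold (R : realType) (n : nat) := RiemannianManifold {
  carrier :> topologicalType;
  chart_index : Type;
  dom : chart_index -> set carrier;
  chart : chart_index -> carrier -> 'rV[R]_n;
  chart_inv : chart_index -> 'rV[R]_n -> carrier;
  chart_at : carrier -> chart_index;
  metric : chart_index -> 'rV[R]_n -> 'M[R]_n;
  manifold_hausdorff : hausdorff_space carrier;
  manifold_second_countable : @second_countable carrier;
  dom_open : forall i, open (dom i);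
  mem_chart_at : forall p, dom (chart_at p) p;
  chart_image_open : forall i, open (chart i @` dom i);
  chartK : forall i p, dom i p -> chart_inv i (chart i p) = p;
  chart_continuous : forall i, {within dom i, continuous (chart i)};
  chart_inv_continuous : forall i,
    {within chart i @` dom i, continuous (chart_inv i)};
  transition_smooth : forall i j (a : 'I_n),
    smooth (chart i @` (dom i `&` dom j))
      (fun x => chart j (chart_inv i x) 0 a);
  metric_smooth : forall i (a b : 'I_n),
    smooth (chart i @` dom i) (fun x => metric i x a b);
  metric_sym : forall i p, dom i p ->
    (metric i (chart i p))^T = metric i (chart i p);
  metric_pos : forall i p (v : 'rV[R]_n), dom i p -> v != 0 ->
    0 < (v *m metric i (chart i p) *m v^T) 0 0;
  metric_transition : forall i j p, dom i p -> dom j p ->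
    let J := 'J (chart j \o chart_inv i) (chart i p) in
    metric i (chart i p) = J *m metric j (chart j p) *m J^T
}.

Section riemannian_distance.
Variables (R : realType) (n : nat) (M : riemannian_manifold R n).
Implicit Types (c : R -> M).

Definition C1_curve c :=
  continuous c /\
  forall i t, dom i (c t) ->
    derivable (chart i \o c) t 1 /\ {for t, continuous (derive1 (chart i \o c))}.

(* Parametrized by [0, 1]: there are breakpoints 0 = t_0 < ... < t_m = 1 such
   that [c] is C^1 on each [t_k, t_(k+1)], with one-sided derivatives at the end
   points; equivalently, it is there the restriction of a C^1 curve defined on
   the whole line. *)
Definition piecewise_C1 c :=
  exists s : seq R, [/\ path <%R 0 s, last 0 s = 1 &
    forall k, (k < size s)%N -> exists2 c', C1_curve c' &
      {in `[nth 0 (0 :: s) k, nth 0 s k], c =1 c'}].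

(* The norm of the velocity. It is not meaningful at the breakpoints of a
   piecewise C^1 curve, which are negligible for [curve_length]. *)
Definition speed c (t : R) : R :=
  let i := chart_at (c t) in
  let v := derive1 (chart i \o c) t in
  Num.sqrt ((v *m metric i (chart i (c t)) *m v^T) 0 0).

Definition curve_length c : \bar R :=
  (\int[lebesgue_measure]_(t in `[0%R, 1%R]) (speed c t)%:E)%E.

(* Points in different connected components are at distance [+oo]. *)
Definition rdist (p q : M) : \bar R :=
  ereal_inf [set curve_length c | c in
    [set c : R -> M | [/\ piecewise_C1 c, c 0 = p & c 1 = q]]].

Definition unit_ball (p : M) : set M := [set q | (rdist p q <= 1)%E].

End riemannian_distance.

Definition std_simplex (R : realType) (k : nat) : set 'rV[R]_k.+1 :=
  [set x | (forall j, 0 <= x 0 j) /\ \sum_j x 0 j = 1].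
Arguments std_simplex R k : clear implicits.

Section face_maps.
Variable R : realType.

Definition face_row (k : nat) (i : 'I_k.+2) (x : 'rV[R]_k.+1) : 'rV[R]_k.+2 :=
  \row_j oapp (x 0) 0 (unlift i j).

Lemma face_row_std (k : nat) (i : 'I_k.+2) (x : 'rV[R]_k.+1) :
  std_simplex R k x -> std_simplex R k.+1 (face_row i x).
Proof.
move=> [x0 x1]; split=> [j|].
  by rewrite mxE; case: unlift => //=.
rewrite (bigD1_ord i) //= mxE unlift_none /= add0r -[RHS]x1.
by apply: eq_bigr => j _; rewrite mxE liftK.
Qed.

Definition face (k : nat) (i : 'I_k.+2) (x : std_simplex R k)
    : std_simplex R k.+1 :=
  SigSub (mem_set (face_row_std i (set_valP x))).

Lemma face_row_continuous (k : nat) (i : 'I_k.+2) : continuous (@face_row k i).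
Proof.
move=> x A [P Px PA]; exists (fun a j => P a (fintype.lift i j)) => [a j|y Py].
  by have := Px a (fintype.lift i j); rewrite !ord1 mxE liftK.
apply: PA => a j; rewrite !ord1 mxE; case: unliftP => [j' ->|->] /=.
  exact: Py.
by have /nbhs_singleton := Px 0 i; rewrite mxE unlift_none.
Qed.

Lemma face_continuous (k : nat) (i : 'I_k.+2) : continuous (@face k i).
Proof.
apply/continuousP => _ [B oB <-]; exists (@face_row k i @^-1` B) => //.
by apply: open_comp => // x _; exact: face_row_continuous.
Qed.

HB.instance Definition _ (k : nat) (i : 'I_k.+2) :=
  isContinuous.Build _ _ (@face k i) (@face_continuous k i).

End face_maps.

Section singular_homology.
Variables (F : comNzRingType) (R : realType) (T : topologicalType).

Definition singular_simplex (k : nat) := continuousType (std_simplex R k) T.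

Definition chain (k : nat) := {freeg (singular_simplex k) / F}.

Definition boundary (k : nat) : chain k.+1 -> chain k :=
  fglift (fun s : singular_simplex k.+1 =>
    \sum_(i < k.+2)
      (-1) ^+ i *: (<< (s \o @face R k i : singular_simplex k) >> : chain k)).

Definition is_cycle (k : nat) : chain k -> Prop :=
  if k is k'.+1 then fun c => boundary c = 0 else fun=> True.

(* [H_k(T; F)] is free of rank [b]: the classes of the cycles [z i] form a
   basis, that is, every cycle is homologous to a unique linear combination of
   them. Over a field, [b] is the dimension of [H_k(T; F)]. *)
Definition homology_rank (k b : nat) : Prop :=
  exists z : 'I_b -> chain k,
    (forall i, is_cycle (z i)) /\
    forall c : chain k, is_cycle c ->
      exists! a : 'rV[F]_b, exists e : chain k.+1,
        c - \sum_i a 0 i *: z i = boundary e.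

End singular_homology.
Arguments homology_rank F {R} T k b.

(* Main.v *)
(* Fix a base point p. If two points q, q' are joined by a path on which d p is
   almost constant, equal to r, then d q q' < 9/10 * (beta + 1). Otherwise the path
   contains points z_0 = q, z_1, ..., z_(beta + 1) with d q z_k = 9/10 * k; let L_k
   be the loop made of a nearly minimizing path from p to z_0, the given path up to
   z_k, and a nearly minimizing path back to p. As UW_1 (B) < 1/15 for the unit
   ball B around z_k, a map from B to a graph separates the points close to z_k from
   the points at distance about 1/4 from z_k, inside the set where d p is well below
   r, by a cut with no common point with the cut along the level set of d p. It
   defines a mod 2 cocycle phi_k (a function on pairs of close points, as in
   Alexander-Spanier cohomology) that counts the passages of a path through a small
   shell around z_k coming from below. Then phi_k (L_j) is 1 if j = k and 0
   otherwise, for 1 <= j, k <= beta + 1, so that L_1, ..., L_(beta + 1) are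
   independent in H_1: this contradicts the definition of beta.
   Hence the path components of the thin slabs {r - 1/100 < d p < r + 1/100} have
   diameter at most 9/10 * (beta + 1) < beta + 1, and mapping a point to the pieces
   it lies in, for the slabs centered at the multiples of 1/100, defines a map from M
   to a (Reeb) graph whose fibers lie in such components. *)
From HB Require Import structures.
From mathcomp Require Import all_boot all_order all_algebra.
From mathcomp Require Import finmap freeg ring lra zify.
From mathcomp Require Import all_classical all_reals all_analysis.
From mathcomp Require Import measurable_realfun.
Require Import Defs.
Import Order.TTheory GRing.Theory Num.Theory.
Import numFieldNormedType.Exports.

Set Implicit Arguments.
Unset Strict Implicit.
Unset Printing Implicit Defensive.

Local Open Scope classical_set_scope.
Local Open Scope ring_scope.

(** * Singular periods of locally defined cocycles *)

(** The part of a small sphere around [z_k] that lies below the slab is a wall with a free edge.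
    Counting its crossings is a cocycle only if no small loop can go around that edge, and this is
    what the width hypothesis provides: in a graph, the partition by the sphere and the partition by
    the level can be made disjoint, so near each point one of them is locally constant and the count
    is a coboundary there. The bound 1/15 has one purpose: a fibre of smaller diameter cannot join
    the two sides of a gap of width 1/15. The two gaps used are from 1/5 to 4/15 in the distance to
    [z_k], and from r - 1/10 to r - 1/30 in the distance to p. The other constants have to fit
    around them: the slab stays above r - 1/30, a nearly minimizing path is below r - 1/10 as soon
    as it is 1/5 away from its end, and the spacing 9/10 keeps the paths towards the other points
    out of the ball of radius 4/15. Functions on pairs of close points are used as cochains because
    they pair with singular simplices by lifting: on a simplex, a local cocycle is the difference of
    a function. *)

Lemma lebesgue_number (R : realType) (T : pseudoMetricType R) (K : set T)
    (P : set T -> Prop) :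
  compact K -> (forall A B, A `<=` B -> P B -> P A) ->
  (forall x, K x -> exists2 U, nbhs x U & P U) ->
  exists2 d : R, 0 < d & forall x, K x -> P (ball x d).
Proof.
move=> /compact_near_coveringP cK Pmono Ploc.
(* The parameter of the near covering is the filter of small positive radii, so that one radius
   serves all the points of [K]. *)
have := cK R (0^'+) (fun d x => P (ball x d)) _ _.
case=> [x Kx|d /= d0 dP].
  have [U /nbhs_ballP[e /= e0 eU] PU] := Ploc x Kx.
  exists (ball x (e / 2), [set d : R | d < e / 2]); first split=> /=.
  - by apply: nbhsx_ballx; rewrite divr_gt0.
  - by apply: nbhs_right_lt; rewrite divr_gt0.
  - move=> [y d] /= [yx de]; apply: Pmono PU => z yz; apply: eU.
    rewrite [e]splitr; apply: ball_triangle yx _.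
    exact: le_ball (ltW de) _ yz.
exists (d / 2); first by rewrite divr_gt0.
apply: dP => /=; last by rewrite divr_gt0.
rewrite sub0r normrN gtr0_norm ?divr_gt0// ltr_pdivrMr// ltr_pMr//.
by rewrite ltr1n.
Qed.

(** * Compactness and convexity of the standard simplices *)

Section std_simplex_convex.
Variables (R : realType) (k : nat).
Local Notation D := (std_simplex R k).

Lemma std_simplex_le1 (x : 'rV[R]_k.+1) j : D x -> x 0 j <= 1.
Proof.
move=> [x0 <-]; rewrite (bigD1 j)//= lerDl; exact: sumr_ge0.
Qed.

Lemma mix_std (t : R) (x y : 'rV[R]_k.+1) : 0 <= t <= 1 -> D x -> D y ->
  D ((1 - t) *: x + t *: y).
Proof.
move=> /andP[t0 t1] [x0 x1] [y0 y1]; split=> [j|].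
  by rewrite !mxE addr_ge0// mulr_ge0// subr_ge0.
under eq_bigr do rewrite !mxE.
by rewrite big_split/= -!mulr_sumr x1 y1 !mulr1 subrK.
Qed.

Lemma std_vertex (i : 'I_k.+1) : D (delta_mx 0 i).
Proof.
split=> [j|]; first by rewrite mxE ler0n.
under eq_bigr do rewrite mxE eqxx/=.
by rewrite (bigD1 i)//= eqxx big1 ?addr0// => j /negbTE ->.
Qed.

Definition vertex (i : 'I_k.+1) : D := SigSub (mem_set (std_vertex i)).

Definition mix (t : R) (ht : 0 <= t <= 1) (x y : D) : D :=
  SigSub (mem_set (mix_std ht (set_valP x) (set_valP y))).

Lemma std_simplex_compact : compact D.
Proof.
apply: (@subclosed_compact _ _ [set v : 'rV[R]_k.+1 | forall i, `[0, 1]%classic (v 0 i)]).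
- rewrite (_ : D = (\bigcap_j [set x : 'rV[R]_k.+1 | 0 <= x 0 j]) `&`
      [set x | \sum_j x 0 j = 1]); last first.
    by apply/seteqP; split=> x /= [h1 h2]; split=> //= j; [move=> _; exact: h1|exact: (h1 j)].
  apply: closedI.
    apply: closed_bigI => j _.
    apply: (@closed_comp _ _ (fun x : 'rV[R]_k.+1 => x 0 j) [set z | 0 <= z]).
      by move=> x _; exact: coord_continuous.
    exact: closed_ge.
  apply: (@closed_comp _ _ (fun x : 'rV[R]_k.+1 => \sum_j x 0 j) [set 1]).
    have cS : continuous (fun x : 'rV[R]_k.+1 => \sum_j x 0 j).
      apply: (@continuous_big R^o 'I_k.+1 +%R 0 xpredT (@add_continuous R^o)).
      by move=> j _ y; exact: coord_continuous.
    by move=> x _; exact: cS.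
  exact: closed_eq.
- by apply: (@rV_compact R _ (fun=> `[0, 1]%classic)) => i; exact: segment_compact.
- by move=> x Dx i /=; rewrite in_itv/= (proj1 Dx) std_simplex_le1.
Qed.

Lemma ball_std (x y : D) (e : R) :
  0 < e -> ball x e y <-> forall j, `|val x 0 j - val y 0 j| < e.
Proof.
move=> e0; split=> [[_ h] j|h]; first exact: (h 0 j).
by split=> // i j; rewrite !ord1; exact: h.
Qed.

Lemma mix0 (ht : (0 : R) <= 0 <= 1) x y : mix ht x y = x.
Proof. by apply: val_inj; rewrite /= subr0 scale1r scale0r addr0. Qed.

Lemma mix1 (ht : (0 : R) <= 1 <= 1) x y : mix ht x y = y.
Proof. by apply: val_inj; rewrite /= subrr scale1r scale0r add0r. Qed.

End std_simplex_convex.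

(** * Lifting a local cocycle along a simplex *)

Section transport.
Variables (R : realType) (T : topologicalType) (G : zmodType).
Variable j : T -> T -> G.

(** Closed 1-cochains in the sense of Alexander and Spanier. Taking [a = b = c] gives
    [j a a = 0]. *)
Definition cocycle_on (U : set T) :=
  forall a b c, U a -> U b -> U c -> j a b + j b c = j a c.

Definition local_cocycle := forall m : T, exists2 U, nbhs m U & cocycle_on U.

Section lift.
Variable k : nat.
Local Notation D := (std_simplex R k).

(** A primitive of the pulled back cochain, valid below one scale [d] on the whole simplex. *)
Definition is_lift (s : D -> T) (F : D -> G) :=
  exists2 d : R, 0 < d & forall x y, ball x d y -> F y - F x = j (s x) (s y).

Lemma ball_mix (t : R) (ht : 0 <= t <= 1) (z x y : D) (d : R) :
  ball x d y -> ball (mix ht z x) d (mix ht z y).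
Proof.
have [d0|d0] := ltP 0 d; last by move=> [/lt_le_trans /(_ d0)]; rewrite ltxx.
move=> /(ball_std _ _ d0) h; apply/ball_std => // i; rewrite !mxE opprD addrACA subrr add0r.
rewrite -mulrBr normrM; case/andP: ht => t0 t1; rewrite ger0_norm//.
by rewrite (le_lt_trans _ (h i))// ler_piMl.
Qed.

Lemma ball_mix_step (t u : R) (ht : 0 <= t <= 1) (hu : 0 <= u <= 1) (x y : D) (d : R) :
  `|t - u| < d -> ball (mix ht x y) d (mix hu x y).
Proof.
move=> tud; have d0 : 0 < d by exact: le_lt_trans tud.
apply/ball_std => // i; rewrite !mxE.
rewrite (_ : _ - _ = (t - u) * (val y 0 i - val x 0 i)); last by rewrite /=; ring.
rewrite normrM (le_lt_trans _ tud)// ler_piMr//.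
have Dx := set_valP x; have Dy := set_valP y.
have := std_simplex_le1 i Dx; have := std_simplex_le1 i Dy.
have := Dx.1 i; have := Dy.1 i; rewrite ler_norml /=; lra.
Qed.

Lemma frac_itv (N i : nat) :
  0 <= ((minn i N.+1)%:R / N.+1%:R : R) <= 1.
Proof.
by rewrite divr_ge0//= ler_pdivrMr// mul1r ler_nat geq_minr.
Qed.

(** The [minn] in the parameter makes the subdivision stop at [y], so that [grid_step] holds for
    every index. *)
Definition grid (N i : nat) (x y : D) : D := mix (frac_itv N i) x y.

Lemma grid0 N x y : grid N 0 x y = x.
Proof.
rewrite /grid; move: (frac_itv _ _); rewrite min0n mul0r => ?; exact: mix0.
Qed.

Lemma gridN N x y : grid N N.+1 x y = y.
Proof.
rewrite /grid; move: (frac_itv _ _); rewrite minnn divff// => ?; exact: mix1.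
Qed.

Lemma grid_step N i x y d : (N.+1%:R^-1 : R) < d ->
  ball (grid N i x y) d (grid N i.+1 x y).
Proof.
move=> Nd; apply: ball_mix_step; rewrite -mulrBl normrM.
rewrite (le_lt_trans _ Nd)// [X in _ * X]ger0_norm ?invr_ge0//.
rewrite ler_piMl ?invr_ge0//; case: (leqP i.+1 N.+1) => iN.
  rewrite !(minn_idPl _)// ?(ltnW iN)//.
  by rewrite distrC -natrB// subSnn normr1.
by rewrite !(minn_idPr _)// ?subrr ?normr0// ltnW.
Qed.

Lemma natSinv_lt (d : R) : 0 < d -> exists N : nat, N.+1%:R^-1 < d.
Proof.
move=> d0; exists (Num.bound d^-1).
rewrite invf_plt ?posrE// (lt_trans (archi_boundP _)) ?invr_ge0 ?ltW//.
by rewrite ltr_nat.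
Qed.

(** Both lifts have the same increments along a fine subdivision of the segment from [x] to [y]. *)
Lemma lift_unique (s : D -> T) F1 F2 x y : is_lift s F1 -> is_lift s F2 ->
  F1 y - F1 x = F2 y - F2 x.
Proof.
move=> [d1 d10 h1] [d2 d20 h2].
have [N Nd] : exists N : nat, N.+1%:R^-1 < Num.min d1 d2.
  by apply: natSinv_lt; rewrite lt_min d10.
move: Nd; rewrite lt_min => /andP[N1 N2].
suff H i : F1 (grid N i x y) - F1 x = F2 (grid N i x y) - F2 x.
  by have := H N.+1; rewrite gridN.
elim: i => [|i IH]; first by rewrite grid0 !subrr.
rewrite -(subrKA (F1 (grid N i x y))) IH -[RHS](subrKA (F2 (grid N i x y))).
by rewrite (h1 (grid N i x y)) ?(h2 (grid N i x y))//; exact: grid_step.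
Qed.

(** A simplex is convex, so closed cochains are exact on it: the lift at [x] is the sum of [j] along
    a finely subdivided segment from a fixed vertex to [x]. *)
Lemma lift_exists (s : D -> T) : local_cocycle -> continuous s ->
  exists F, is_lift s F.
Proof.
move=> lc cs.
have [|A B AB|x Dx|d d0 hd] := @lebesgue_number R _ D
    (fun A => cocycle_on (s @` (set_val @^-1` A))).
- exact: std_simplex_compact.
- move=> h a b c [a' Aa <-] [b' Ab <-] [c' Ac <-].
  by apply: h; [exists a'|exists b'|exists c'] => //; exact: AB.
- pose x' : D := SigSub (mem_set Dx).
  have [U Us hU] := lc (s x').
  have [B [oB Bx] BU] : exists2 B : set 'rV[R]_k.+1, open B /\ B x &
      forall y : D, B (val y) -> U (s y).
    have [_ [[B oB <-] Bx] BU] := cs x' U Us.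
    by exists B => // y By; exact: BU.
  exists B; first exact: open_nbhs_nbhs.
  move=> a b c [a' Aa <-] [b' Ab <-] [c' Ac <-].
  by apply: hU; apply: BU.
have cyc (z a b c : D) : ball z d a -> ball z d b -> ball z d c ->
    j (s a) (s b) + j (s b) (s c) = j (s a) (s c).
  move=> za zb zc; apply: (hd (val z) (set_valP z)).
  - by exists a.
  - by exists b.
  - by exists c.
(* Half the Lebesgue number, because the diagonal of a square between two neighbouring segments
   takes two steps. *)
have [N Nd] : exists N : nat, N.+1%:R^-1 < d / 2.
  by apply: natSinv_lt; rewrite divr_gt0.
pose o : D := vertex R (ord0 : 'I_k.+1).
pose p i x := grid N i o x.
exists (fun x => \sum_(i < N.+1) j (s (p i x)) (s (p i.+1 x))).
exists (d / 2); first by rewrite divr_gt0.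
move=> x y xy.
have d2d : d / 2 <= d by rewrite ler_pdivrMr// ler_pMr// ler1n.
have xx (z : D) : ball z d z by exact: ballxx.
(* Discrete homotopy: after [n] squares the two partial sums differ by the rung from [p n x] to
   [p n y]. The last rung is the increment from [x] to [y]. *)
suff H n : \sum_(i < n) j (s (p i x)) (s (p i.+1 x)) + j (s (p n x)) (s (p n y))
    = \sum_(i < n) j (s (p i y)) (s (p i.+1 y)).
  by have <- := H N.+1; rewrite /p !gridN addrAC subrr add0r.
elim: n => [|n IH].
  rewrite !big_ord0 add0r /p !grid0.
  by apply: (addrI (j (s o) (s o))); rewrite addr0 (cyc o).
rewrite !big_ord_recr/= -IH -!addrA; congr (_ + _).
have h1 : ball (p n x) d (p n.+1 x).
  by apply: (le_ball d2d); exact: grid_step.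
have h2 : ball (p n x) d (p n y) by apply: (le_ball d2d); exact: ball_mix.
have h3 : ball (p n x) d (p n.+1 y).
  rewrite [d]splitr; apply: (@ball_triangle _ _ (p n y)); first exact: ball_mix.
  exact: grid_step.
by rewrite (cyc (p n x))// (cyc (p n x)).
Qed.

End lift.
End transport.

Lemma fglift_is_zmod_morphism (R : nzRingType) (K : choiceType) (M : lmodType R)
  (f : K -> M) : zmod_morphism (fglift f).
Proof. exact: lift_is_additive. Qed.

HB.instance Definition _ (R : nzRingType) (K : choiceType) (M : lmodType R)
  (f : K -> M) := GRing.isZmodMorphism.Build _ _ (fglift f) (fglift_is_zmod_morphism f).

Lemma fglift_is_scalable (R : nzRingType) (K : choiceType) (M : lmodType R)
  (f : K -> M) : scalable (fglift f).
Proof.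
move=> c D; rewrite -[in RHS](freeg_sumE D).
have -> : c *: D = \sum_(z <- freeg.dom D) << c * coeff z D *g z >> by [].
rewrite !raddf_sum; apply: eq_bigr => z _; by rewrite /= !liftU scalerA.
Qed.

HB.instance Definition _ (R : nzRingType) (K : choiceType) (M : lmodType R)
  (f : K -> M) := GRing.isScalable.Build _ _ _ _ (fglift f) (fglift_is_scalable f).

(** * Periods of a local cocycle on singular 1-chains *)

Section cocycle_functional.
Variables (F : comNzRingType) (R : realType) (T : topologicalType).
Variable j : T -> T -> F^o.
Hypothesis lc : local_cocycle j.

Definition lift_of k (s : singular_simplex R T k) : std_simplex R k -> F^o :=
  xget (fun=> 0) [set f | is_lift j s f].

Lemma lift_ofP k (s : singular_simplex R T k) : is_lift j s (lift_of s).
Proof.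
rewrite /lift_of; case: xgetP => [f _ //|nof].
have [f hf] := @lift_exists R T _ j k s lc (@cts_fun _ _ s).
by case: (nof f).
Qed.

Definition transport (s : singular_simplex R T 1) : F^o :=
  lift_of s (vertex R ord_max) - lift_of s (vertex R ord0).

Lemma transportE (s : singular_simplex R T 1) f : is_lift j s f ->
  transport s = f (vertex R ord_max) - f (vertex R ord0).
Proof. by move=> hf; apply: lift_unique (lift_ofP s) hf. Qed.

Definition period : chain F R T 1 -> F^o := fglift transport.

Lemma is_lift_face k (s : singular_simplex R T k.+1) (i : 'I_k.+2) f :
  is_lift j s f -> is_lift j (s \o @face R k i) (f \o @face R k i).
Proof.
move=> [d d0 hf]; exists d => // x y xy; apply: hf.
apply/ball_std => // a; rewrite !mxE.
case: (unliftP i a) => [b _|_] /=; last by rewrite subrr normr0.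
by move/ball_std : xy; apply.
Qed.

Lemma face_vertex k (i : 'I_k.+2) (a : 'I_k.+1) :
  face i (vertex R a) = vertex R (fintype.lift i a).
Proof.
apply: val_inj; apply/rowP => b; rewrite !mxE eqxx/=.
case: (unliftP i b) => [c ->|->] /=.
  by rewrite !mxE eqxx/= (inj_eq lift_inj).
by rewrite (negbTE (neq_lift _ _)).
Qed.

(** A lift on the triangle restricts to lifts on its three edges, so the alternating sum of end
    point differences telescopes. *)
Lemma period_boundary (e : chain F R T 2) : period (boundary e) = 0.
Proof.
have liftE (s : singular_simplex R T 2) i :
    transport (s \o @face R 1 i : singular_simplex R T 1) =
    lift_of s (vertex R (fintype.lift i ord_max)) -
    lift_of s (vertex R (fintype.lift i ord0)).
  rewrite (transportE (f := lift_of s \o @face R 1 i))/= ?face_vertex//.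
  exact: is_lift_face (lift_ofP s).
have per0 (s : singular_simplex R T 2) : period (\sum_(i < 3)
    (-1) ^+ i *: (<< (s \o @face R 1 i : singular_simplex R T 1) >> : chain F R T 1)) = 0.
  rewrite /period raddf_sum/=.
  under eq_bigr do rewrite linearZ/= liftU scale1r liftE.
  rewrite !big_ord_recl big_ord0 addr0 /= expr0 expr1 scale1r scaleN1r.
  rewrite /bump/= sqrrN expr1n scale1r.
  have -> : fintype.lift (ord0 : 'I_3) (ord0 : 'I_2) = 1 by apply: val_inj.
  have -> : fintype.lift (1 : 'I_3) (ord_max : 'I_2) = ord_max by apply: val_inj.
  have -> : fintype.lift (1 : 'I_3) (ord0 : 'I_2) = ord0 by apply: val_inj.
  have -> : fintype.lift (ord0 : 'I_3) (ord_max : 'I_2) = ord_max by apply: val_inj.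
  set z := fintype.lift ord0 (fintype.lift ord0 ord0).
  have -> : fintype.lift z (ord_max : 'I_2) = 1 by apply: val_inj.
  have -> : fintype.lift z (ord0 : 'I_2) = ord0 by apply: val_inj.
  by rewrite opprB (addrC (_ - lift_of s (vertex R ord_max))) !subrKA subrr.
rewrite -[e]freeg_sumE /boundary /period !raddf_sum big1// => s _.
by rewrite /= liftU linearZ/= [fglift _ _]per0 scaler0.
Qed.

End cocycle_functional.

(** * Paths as singular 1-simplices *)

Section path_simplex.
Variables (F : comNzRingType) (R : realType) (T : topologicalType).

Definition path_fun (g : R -> T) (x : std_simplex R 1) : T := g (val x 0 1).

Lemma path_fun_continuous (g : R -> T) : continuous g -> continuous (path_fun g).
Proof.
move=> cg x; apply: continuous_comp; last exact: cg.
have cv : continuous (val : std_simplex R 1 -> 'rV[R]_2).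
  exact: (@initial_continuous (std_simplex R 1) _ set_val).
exact: (continuous_comp (cv x) (@coord_continuous R 1 2 0 1 (val x))).
Qed.

Definition path_simplex (g : R -> T) (cg : continuous g) : singular_simplex R T 1 :=
  mkcts (path_fun_continuous cg).

Lemma const_continuous (x : T) : continuous (fun _ : std_simplex R 0 => x).
Proof. by move=> y; exact: cst_continuous. Qed.

Definition point_simplex (x : T) : singular_simplex R T 0 :=
  mkcts (@const_continuous x).

Lemma boundary_path g (cg : continuous g) :
  boundary (<< path_simplex cg >> : chain F R T 1) =
  << point_simplex (g 1) >> - << point_simplex (g 0) >>.
Proof.
have e1 (x : std_simplex R 0) : val x 0 0 = 1.
  by have [_] := set_valP x; rewrite big_ord1.
rewrite /boundary liftU scale1r !big_ord_recl big_ord0 addr0/=.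
rewrite expr0 expr1 scale1r scaleN1r; congr (<< _ >> - << _ >>).
  apply/continuousEP => x; rewrite /= /mkcts /path_fun; congr g.
  rewrite mxE (_ : 1 = fintype.lift ord0 ord0 :> 'I_2); last exact: val_inj.
  by rewrite liftK/= e1.
apply/continuousEP => x; rewrite /= /mkcts /path_fun; congr g.
rewrite mxE (_ : 1 = fintype.lift ord0 ord0 :> 'I_2); last exact: val_inj.
by rewrite unlift_none.
Qed.

(** The period of a path can be computed from any local primitive along it; compactness of [0, 1]
    makes the local scale uniform, which turns the primitive into a lift. *)
Lemma transport_path (j : T -> T -> F^o) (lc : local_cocycle j)
    (g : R -> T) (cg : continuous g) (f : R -> F^o) :
  (forall t : R, 0 <= t <= 1 -> exists2 U, nbhs t U &
    forall a b, U a -> U b -> 0 <= a <= 1 -> 0 <= b <= 1 ->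
      f b - f a = j (g a) (g b)) ->
  transport j (path_simplex cg) = f 1 - f 0.
Proof.
move=> loc.
have [|A B AB|t t01|d d0 hd] := @lebesgue_number R R `[0, 1]%classic
    (fun A : set R => forall a b, A a -> A b -> 0 <= a <= 1 -> 0 <= b <= 1 ->
      f b - f a = j (g a) (g b)).
- exact: segment_compact.
- by move=> h a b Aa Ab; apply: h; exact: AB.
- by apply: loc; move: t01; rewrite /= in_itv.
have x01 (x : std_simplex R 1) : 0 <= val x 0 1 <= 1.
  by rewrite (set_valP x).1 std_simplex_le1//; exact: set_valP.
rewrite (transportE lc (f := fun x : std_simplex R 1 => f (val x 0 1))).
  by rewrite /= !mxE.
exists d => // x y /(ball_std _ _ d0) xy; apply: (hd (val x 0 1)) => //.
- by rewrite /= in_itv/= x01.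
- exact: ballxx.
- exact: xy.
Qed.

End path_simplex.

(* A family of cycles with a dual family of cocycles is linearly independent in
   homology: the identity matrix factors through the space of coordinates. *)
Lemma homology_rank_dual (F : fieldType) (R : realType) (T : topologicalType)
    (b m : nat) (L : 'I_m -> chain F R T 1) (j : 'I_m -> T -> T -> F^o) :
  homology_rank (R := R) F T 1 b ->
  (forall i, is_cycle (L i)) -> (forall k, local_cocycle (j k)) ->
  (forall i k, period (j k) (L i) = (i == k)%:R) -> (m <= b)%N.
Proof.
move=> [z [_ basis]] cycL lcj dual.
have /choice[a ha] i : exists a : 'rV[F]_b, exists e : chain F R T 2,
    L i - \sum_l a 0 l *: z l = boundary e.
  by have [a [ha _]] := basis (L i) (cycL i); exists a.
pose A : 'M[F]_(m, b) := \matrix_(i, l) a i 0 l.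
pose B : 'M[F]_(b, m) := \matrix_(l, k) period (j k) (z l).
have AB : A *m B = 1%:M.
  apply/matrixP => i k; rewrite !mxE -dual.
  have [e he] := ha i.
  have -> : L i = boundary e + \sum_l a i 0 l *: z l by rewrite -he subrK.
  rewrite /period raddfD/= [fglift _ (boundary e)]period_boundary ?add0r//.
  rewrite raddf_sum; apply: eq_bigr => l _.
  by rewrite !mxE; exact/esym/(fglift_is_scalable (transport (j k))).
have := mxrankM_maxl A B; rewrite AB mxrank1 => /leq_trans; apply.
exact: rank_leq_col.
Qed.

(** * Curves and Riemannian distance *)

Section matrix_limits.
Variable R : realType.

Lemma mx_norm_le m n (x : 'M[R]_(m, n)) (e : R) :
  0 <= e -> (forall i j, `|x i j| <= e) -> `|x| <= e.
Proof.
move=> e0 h; rewrite (_ : `|x| = mx_norm x)//.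
have [->//|/eqP/mx_norm_neq0[[i j] ->]] := pselect (mx_norm x = 0).
exact: h.
Qed.

Lemma le_mx_norm m n (x : 'M[R]_(m, n)) i j : `|x i j| <= `|x|.
Proof.
by rewrite [leRHS]mx_normrE (le_bigmax _ (fun ij : 'I_m * 'I_n => `|x ij.1 ij.2|) (i, j)).
Qed.

Lemma cvg_mx m n (T : Type) (F : set_system T) (FF : Filter F)
    (f : T -> 'M[R]_(m, n)) (l : 'M[R]_(m, n)) :
  (forall i j, f x i j @[x --> F] --> l i j) -> f @ F --> l.
Proof.
move=> h; apply/cvgrPdist_lt => e e0.
have e20 : 0 < e / 2 by rewrite divr_gt0.
have : \forall x \near F, forall i, forall j, `|l i j - f x i j| < e / 2.
  apply: filter_forall => i; apply: filter_forall => j.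
  by move/cvgrPdist_lt : (h i j); apply.
apply: filterS => x hx; apply: (@le_lt_trans _ _ (e / 2)).
  by apply: mx_norm_le => [|i j]; [exact: ltW|rewrite !mxE; exact: ltW].
by rewrite ltr_pdivrMr// ltr_pMr// ltr1n.
Qed.

Lemma cvg_coord m n (T : Type) (F : set_system T) (FF : Filter F)
    (f : T -> 'M[R]_(m, n)) (l : 'M[R]_(m, n)) i j :
  f @ F --> l -> f x i j @[x --> F] --> l i j.
Proof. by move=> h; exact: cvg_comp h (@coord_continuous R m n i j l). Qed.

Lemma cvg_mulmx m n p (T : Type) (F : set_system T) (FF : Filter F)
    (f : T -> 'M[R]_(m, n)) (g : T -> 'M[R]_(n, p))
    (l : 'M[R]_(m, n)) (k : 'M[R]_(n, p)) :
  f @ F --> l -> g @ F --> k -> f x *m g x @[x --> F] --> l *m k.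
Proof.
move=> fl gk; apply: cvg_mx => i j; rewrite mxE; under eq_cvg do rewrite mxE.
apply: (@cvg_big R^o 'I_n +%R 0 xpredT (@add_continuous R^o)) => a _.
by apply: cvgM; exact: cvg_coord.
Qed.

Lemma cvg_trmx m n (T : Type) (F : set_system T) (FF : Filter F)
    (f : T -> 'M[R]_(m, n)) (l : 'M[R]_(m, n)) : f @ F --> l -> (f x)^T @[x --> F] --> l^T.
Proof.
by move=> fl; apply: cvg_mx => i j; rewrite mxE; under eq_cvg do rewrite mxE;
  exact: cvg_coord.
Qed.

End matrix_limits.

(** * Functions with continuous partial derivatives are differentiable *)

Section C1_differentiable.
Variables (R : realType) (n : nat).
Implicit Types (U : set 'rV[R]_n).

Lemma mean_value (g dg : R -> R) (h : R) :
  (forall t : R, `|t| <= `|h| -> is_derive t 1 g (dg t)) ->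
  exists2 c : R, `|c| <= `|h| & g h - g 0 = dg c * h.
Proof.
move=> dgP; have [h0|h0] := leP 0 h.
  have [t|t|c] := @MVT_segment R g dg 0 h h0.
  - rewrite in_itv/= => /andP[t0 th]; apply: dgP.
    by rewrite !ger0_norm// ltW.
  - apply: (@derivable_within_continuous R R^o g `[0, h]) => z; rewrite in_itv/= => /andP[z0 zh].
    have dz : is_derive z 1 g (dg z) by apply: dgP; rewrite !ger0_norm.
    exact: ex_derive.
  - rewrite in_itv/= subr0 => /andP[c0 ch] ->; exists c => //.
    by rewrite !ger0_norm.
have [t|t|c] := @MVT_segment R g dg h 0 (ltW h0).
- rewrite in_itv/= => /andP[t0 th]; apply: dgP.
  by rewrite !ler0_norm// ?lerN2 ltW.
- apply: (@derivable_within_continuous R R^o g `[h, 0]) => z; rewrite in_itv/= => /andP[z0 zh].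
  have dz : is_derive z 1 g (dg z) by apply: dgP; rewrite !ler0_norm ?lerN2// ltW.
  exact: ex_derive.
- rewrite in_itv/= sub0r => /andP[c0 ch] gE; exists c.
    by rewrite !ler0_norm ?lerN2// ltW.
  by rewrite -[LHS]opprB gE mulrN opprK.
Qed.

Lemma is_derive_line (f : 'rV[R]_n -> R) (y v : 'rV[R]_n) (t : R) :
  derivable f (y + t *: v) v ->
  is_derive t 1 (fun s => f (y + s *: v)) ('D_v f (y + t *: v)).
Proof.
move=> df.
have E : (fun h : R => h^-1 *: (f (y + (h *: 1 + t) *: v) - f (y + t *: v))) =
    (fun h => h^-1 *: (f (h *: v + (y + t *: v)) - f (y + t *: v))).
  by apply/funext => h; rewrite scalerDl [h *: 1](mulr1 h) (addrCA (h *: v)).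
by apply: DeriveDef; rewrite /derivable /derive /= E.
Qed.

(** The way from [x] to [h + x] changes one coordinate at a time, and the mean value theorem applies
    to each step. *)
Lemma C1_increment (f : 'rV[R]_n -> R) U (x : 'rV[R]_n) (e : R) :
  open U -> U x -> Ck 1 U f -> 0 < e ->
  \forall h \near (0 : 'rV[R]_n),
    `|f (h + x) - f x - \sum_j h 0 j * 'D_(delta_mx 0 j) f x| <= e * `|h|.
Proof.
move=> oU Ux [fc dfC] e0.
(* The [n] steps share the error [e]; the successor covers [n = 0]. *)
pose e' := e / n.+1%:R.
have e'0 : 0 < e' by rewrite divr_gt0.
have [d /= d0 hd] : exists2 d : R, 0 < d & forall y, `|x - y| < d -> U y /\
    forall j, `|'D_(delta_mx 0 j) f x - 'D_(delta_mx 0 j) f y| < e'.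
  have : \forall y \near x, U y /\
      forall j, `|'D_(delta_mx 0 j) f x - 'D_(delta_mx 0 j) f y| < e'.
    near=> y; split; first by near: y; exact: open_nbhs_nbhs.
    near: y; apply: filter_forall => j.
    have [_ [/(_ x Ux) cj _]] := dfC j.
    by move/cvgrPdist_lt : cj; apply.
  by move=> /nbhs_normP[d d0 hd]; exists d => // y xy; exact: hd.
near=> h.
have hd' : `|h| < d.
  by near: h; exact: (@nbhs0_lt R 'rV[R]_n d d0).
pose p k : 'rV[R]_n := x + \row_j (if (j < k)%N then h 0 j else 0).
have p0 : p 0%N = x by rewrite /p (_ : \row_j _ = 0) ?addr0//; apply/rowP => j; rewrite !mxE.
have pn : p n = h + x.
  by rewrite /p addrC; congr (_ + _); apply/rowP => j; rewrite !mxE ltn_ord.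
have pS (k : 'I_n) : p k.+1 = p k + h 0 k *: delta_mx 0 k.
  rewrite /p -addrA; congr (_ + _); apply/rowP => j; rewrite !mxE eqxx/= ltnS leq_eqVlt.
  have [->|jk] := eqVneq j k; first by rewrite eqxx ltnn/= add0r mulr1.
  by rewrite -val_eqE in jk; rewrite (negbTE jk)/= mulr0 addr0.
have step (k : 'I_n) : `|f (p k.+1) - f (p k) - h 0 k * 'D_(delta_mx 0 k) f x| <= e' * `|h|.
  have near_x (c : R) : `|c| <= `|h 0 k| -> `|x - (p k + c *: delta_mx 0 k)| < d.
    move=> ck; apply: le_lt_trans hd'; rewrite /p -addrA opprD addNKr.
    apply: mx_norm_le => // i j; rewrite !ord1 !mxE eqxx/= normrN.
    have [->|jk] := eqVneq j k.
      by rewrite ltnn add0r mulr1 (le_trans ck)// le_mx_norm.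
    by rewrite mulr0 addr0; case: ifP => _; rewrite ?normr0// le_mx_norm.
  have [t tk|c ck] := @mean_value (fun t => f (p k + t *: delta_mx 0 k))
      (fun t => 'D_(delta_mx 0 k) f (p k + t *: delta_mx 0 k)) (h 0 k).
    apply: is_derive_line; have [dk _] := dfC k; apply: dk.
    by have [] := hd _ (near_x t tk).
  rewrite -pS scale0r addr0 => ->.
  rewrite mulrC -mulrBr normrM mulrC ler_pM//; last exact: le_mx_norm.
  by rewrite distrC ltW//; have [_] := hd _ (near_x c ck); apply.
rewrite -pn -[in f x]p0 -(telescope_sumr (f \o p)) //= big_mkord -sumrB.
apply: (le_trans (ler_norm_sum _ _ _)).
apply: (@le_trans _ _ (\sum_(k < n) e' * `|h|)); first exact: ler_sum.
rewrite sumr_const card_ord -mulrnAl ler_wpM2r// /e' -mulr_natr -mulrA ger_pMr//.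
by rewrite mulrC ler_pdivrMr// mul1r ler_nat.
Unshelve. all: by end_near. Qed.

(** [Ck] speaks of partial derivatives, whereas the chain rule between charts needs the
    differential. *)
Lemma C1_jacobian m (f : 'rV[R]_n -> 'rV[R]_m) U (x : 'rV[R]_n) :
  open U -> U x -> (forall a, Ck 1 U (fun y => f y 0 a)) ->
  differentiable f x /\
  'J f x = \matrix_(j, a) 'D_(delta_mx 0 j) (fun y => f y 0 a) x.
Proof.
move=> oU Ux fC.
pose A := \matrix_(j < n, a < m) 'D_(delta_mx 0 j) (fun y => f y 0 a) x.
have cA : continuous (mulmxr A : 'rV[R]_n -> 'rV[R]_m).
  by move=> y; apply: (@cvg_mulmx R 1 n m _ (nbhs y) _ id (cst A)); [exact: cvg_id|exact: cvg_cst].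
have fA : f \o shift x = cst (f x) + mulmxr A +o_ (0 : 'rV[R]_n) id.
  apply/eqaddoP => e e0; have : \forall h \near (0 : 'rV[R]_n), forall a : 'I_m,
      `|f (h + x) 0 a - f x 0 a - \sum_j h 0 j * 'D_(delta_mx 0 j) (fun y => f y 0 a) x|
      <= e * `|h|.
    have H a := C1_increment oU Ux (fC a) e0.
    exact: filter_forall H.
  apply: filterS => h hh /=; apply: mx_norm_le => [|i a].
    by rewrite mulr_ge0// ltW.
  rewrite !ord1; move: (hh a); rewrite !mxE opprD addrA.
  by under [in X in _ -> X]eq_bigr do rewrite mxE.
have dfE : 'd f x = mulmxr A :> (_ -> _) by exact: diff_unique.
split; first by apply/diff_locallyP; rewrite dfE.
by apply/row_matrixP => i; rewrite !rowE /jacobian mul_rV_lin1 dfE.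
Qed.

End C1_differentiable.

(** * Velocity and speed in charts *)

Section curves.
Variables (R : realType) (n : nat) (M : riemannian_manifold R n).
Implicit Types (c : R -> M) (i j : chart_index M).

Lemma chart_cvg i p : dom i p -> {for p, continuous (chart i)}.
Proof.
move=> ip; have := @chart_continuous _ _ M i.
by rewrite continuous_open_subspace; [apply; rewrite inE|exact: dom_open].
Qed.

Lemma chart_inv_cvg i x : (chart i @` dom i) x -> {for x, continuous (chart_inv i)}.
Proof.
move=> ix; have := @chart_inv_continuous _ _ M i.
by rewrite continuous_open_subspace; [apply; rewrite inE|exact: chart_image_open].
Qed.

Lemma transition_dom_open i j : open (chart i @` (dom i `&` dom j)).
Proof.
rewrite openE => _ [p [ip jp] <-]; rewrite /interior.
have ix : (chart i @` dom i) (chart i p) by exists p.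
have : \forall y \near chart i p, (chart i @` dom i) y /\ dom j (chart_inv i y).
  apply: filterI; first exact: open_nbhs_nbhs (conj (@chart_image_open _ _ M i) ix).
  apply: (chart_inv_cvg ix); rewrite chartK//.
  exact: open_nbhs_nbhs (conj (@dom_open _ _ M j) jp).
apply: filterS => y [[q iq <-]]; rewrite chartK// => jq; by exists q.
Qed.

Lemma transition_C1 i j (a : 'I_n) :
  Ck 1 (chart i @` (dom i `&` dom j)) (fun x => chart j (chart_inv i x) 0 a).
Proof. exact: (transition_smooth i j a 1). Qed.

Lemma transition_jacobian i j p : dom i p -> dom j p ->
  differentiable (chart j \o chart_inv i) (chart i p) /\
  {for chart i p, continuous (fun x => 'J (chart j \o chart_inv i) x)}.
Proof.
move=> ip jp; have W : (chart i @` (dom i `&` dom j)) (chart i p) by exists p.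
have oW := @transition_dom_open i j.
split; first exact: (C1_jacobian oW W (transition_C1 i j)).1.
have JE : \forall x \near chart i p, \matrix_(k, a)
    'D_(delta_mx 0 k) (fun y => (chart j \o chart_inv i) y 0 a) x =
    'J (chart j \o chart_inv i) x.
  near=> x; rewrite (C1_jacobian oW _ (transition_C1 i j)).2//.
  by near: x; exact: open_nbhs_nbhs.
rewrite /prop_for /continuous_at (C1_jacobian oW W (transition_C1 i j)).2.
apply: cvg_trans (near_eq_cvg JE) _; apply: cvg_mx => k a.
under eq_cvg do rewrite mxE; rewrite mxE.
have [_ /(_ k)[_ [+ _]]] := transition_C1 i j a.
by apply.
Unshelve. all: by end_near. Qed.

Lemma velocity_change c t i j : {for t, continuous c} ->
  dom i (c t) -> dom j (c t) -> derivable (chart i \o c) t 1 ->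
  derivable (chart j \o c) t 1 /\
  derive1 (chart j \o c) t =
    derive1 (chart i \o c) t *m 'J (chart j \o chart_inv i) (chart i (c t)).
Proof.
move=> cc ip jp dc; have [dT _] := transition_jacobian ip jp.
have E : \forall s \near t, ((chart j \o chart_inv i) \o (chart i \o c)) s = (chart j \o c) s.
  have : \forall s \near t, dom i (c s).
    by apply: cc; exact: open_nbhs_nbhs (conj (@dom_open _ _ M i) ip).
  by apply: filterS => s is_ /=; rewrite chartK.
have dic : differentiable (chart i \o c) t by exact/derivable1_diffP.
have dcomp := differentiable_comp dic dT.
split.
  by apply: near_eq_derivable E _; apply/derivable1_diffP.
rewrite derive1E -(near_eq_derive _ E) -derive1E derive1E'// diff_comp//=.
by rewrite -derive1E' // /jacobian mul_rV_lin1.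
Qed.

(** One chart at each time suffices, since in another chart the velocity is multiplied by the
    continuous Jacobian of the transition. *)
Lemma C1_curve_chart c : continuous c ->
  (forall t, exists i, [/\ dom i (c t), derivable (chart i \o c) t 1 &
     {for t, continuous (derive1 (chart i \o c))} /\
     \forall s \near t, derivable (chart i \o c) s 1]) ->
  C1_curve c.
Proof.
move=> cc h; split=> // j t jt; have [i [it dit [cit nit]]] := h t.
split; first exact: (velocity_change (cc t) it jt dit).1.
have E : \forall s \near t, derive1 (chart i \o c) s *m
    'J (chart j \o chart_inv i) (chart i (c s)) = derive1 (chart j \o c) s.
  near=> s; have is_ : dom i (c s).
    near: s; apply: (cc t); exact: open_nbhs_nbhs (conj (@dom_open _ _ M i) it).
  have js : dom j (c s).
    near: s; apply: (cc t); exact: open_nbhs_nbhs (conj (@dom_open _ _ M j) jt).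
  have ds : derivable (chart i \o c) s 1 by near: s.
  by rewrite (velocity_change (cc s) is_ js ds).2.
rewrite /prop_for /continuous_at (velocity_change (cc t) it jt dit).2.
apply: cvg_trans (near_eq_cvg E) _; apply: cvg_mulmx; first exact: cit.
have [_ cJ] := transition_jacobian it jt.
apply: (@cvg_comp _ _ _ (chart i \o c) (fun x => 'J (chart j \o chart_inv i) x) _ (nbhs (chart i (c t)))) => //.
apply: (@continuous_comp _ _ _ c (chart i)); first exact: cc.
exact: chart_cvg.
Unshelve. all: by end_near. Qed.

Definition speed_in i c t : R :=
  let v := derive1 (chart i \o c) t in
  Num.sqrt ((v *m metric i (chart i (c t)) *m v^T) 0 0).

(** [metric_transition] absorbs the Jacobian of the change of chart. The chart chosen by [chart_at]
    may jump along the curve, and this lemma replaces it by a fixed one near a given time. *)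
Lemma speed_chart c t i : {for t, continuous c} -> dom i (c t) ->
  derivable (chart i \o c) t 1 -> speed c t = speed_in i c t.
Proof.
move=> cc it dit; have jt := mem_chart_at (c t).
rewrite /speed /speed_in (velocity_change cc it jt dit).2.
have /= -> := metric_transition it jt.
by rewrite trmx_mul !mulmxA.
Qed.

Lemma C1_speed_continuous c : C1_curve c -> continuous (speed c).
Proof.
move=> [cc dc] t; pose i := chart_at (c t); have it : dom i (c t) := mem_chart_at (c t).
have [dit cit] := dc i t it.
have E : \forall s \near t, speed_in i c s = speed c s.
  near=> s; have is_ : dom i (c s).
    near: s; apply: (cc t); exact: open_nbhs_nbhs (conj (@dom_open _ _ M i) it).
  by rewrite (speed_chart (cc s) is_ (dc i s is_).1).
rewrite /continuous_at (speed_chart (cc t) it dit).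
apply: cvg_trans (near_eq_cvg E) _.
apply: (@cvg_comp _ _ _ (fun s => (derive1 (chart i \o c) s *m metric i (chart i (c s)) *m
   (derive1 (chart i \o c) s)^T) 0 0) Num.sqrt); last exact: sqrt_continuous.
apply: cvg_coord; apply: cvg_mulmx; last by apply: cvg_trmx; exact: cit.
apply: cvg_mulmx; first exact: cit.
apply: (@cvg_comp _ _ _ (chart i \o c) (fun x => metric i x) _ (nbhs (chart i (c t)))).
  apply: (@continuous_comp _ _ _ c (chart i)); first exact: cc.
  exact: chart_cvg.
apply: cvg_mx => a b.
have [+ _] := metric_smooth i a b 0%N; apply.
by exists (c t).
Unshelve. all: by end_near. Qed.

Lemma speed_ge0 c t : 0 <= speed c t.
Proof. exact: sqrtr_ge0. Qed.

End curves.

(** * Affine reparametrization of curves *)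

Section reparametrization.
Variables (R : realType) (n : nat) (M : riemannian_manifold R n).
Implicit Types (c : R -> M) (i j : chart_index M).

Definition affine (a b t : R) : R := a + b * t.

Lemma is_derive_affine (a b t : R) : is_derive t 1 (affine a b) b.
Proof.
have da : is_derive t 1 (cst a + b \*: id : R -> R) (0 + b *: 1).
  exact: is_deriveD.
by rewrite add0r [_ *: _]mulr1 in da.
Qed.

Lemma derive1_affineE (a b : R) : derive1 (affine a b) = cst b.
Proof. by apply/funext => t; rewrite derive1E; have [] := is_derive_affine a b t. Qed.

Lemma derivable_affine (a b t : R) : derivable (affine a b) t 1.
Proof. by have [] := is_derive_affine a b t. Qed.

Lemma differentiable_affine (a b t : R) : differentiable (affine a b) t.
Proof. exact/derivable1_diffP/derivable_affine. Qed.

Lemma affine_continuous a b : continuous (affine a b).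
Proof.
by move=> t; exact/differentiable_continuous/differentiable_affine.
Qed.

Lemma derive1_affine (V : normedModType R) (g : R -> V) a b t :
  derivable g (affine a b t) 1 ->
  derivable (g \o affine a b) t 1 /\
  derive1 (g \o affine a b) t = b *: derive1 g (affine a b t).
Proof.
move=> dg1; have dg : differentiable g (affine a b t) by exact/derivable1_diffP.
have da := differentiable_affine a b t.
have dga := differentiable_comp da dg.
split; first exact/derivable1_diffP.
rewrite (derive1E' dga) (diff_comp da dg) [LHS](_ : _ = 'd g (affine a b t) b).
  by rewrite (deriv1E dg1).
by congr ('d g (affine a b t) _); rewrite -(derive1E' da) derive1_affineE.
Qed.

Lemma C1_affine c a b : C1_curve c -> C1_curve (c \o affine a b).
Proof.
move=> [cc dc]; split=> [t|i t it].
  by apply: continuous_comp; [exact: affine_continuous|exact: cc].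
have [dit cit] := dc i _ it.
have [d1 d2] := derive1_affine dit.
split; first exact: d1.
pose F s := b *: derive1 (chart i \o c) (affine a b s).
have E : \forall s \near t, F s = derive1 (chart i \o (c \o affine a b)) s.
  near=> s; have is_ : dom i (c (affine a b s)).
    near: s; apply: (continuous_comp (@affine_continuous a b t) (cc _)).
    exact: open_nbhs_nbhs (conj (@dom_open _ _ M i) it).
  have [_ d3] := derive1_affine (dc i _ is_).1; exact: esym d3.
have cG : (derive1 (chart i \o c) \o affine a b) s @[s --> t] -->
    derive1 (chart i \o c) (affine a b t).
  exact: (continuous_comp (@affine_continuous a b t) cit).
have cF : F s @[s --> t] --> F t.
  apply: cvg_mx => k l; rewrite mxE; under eq_cvg do rewrite mxE.
  by apply: cvgM; [exact: cvg_cst|exact: cvg_coord cG].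
have d2' : derive1 (chart i \o (c \o affine a b)) t = F t by exact: d2.
rewrite /prop_for /continuous_at d2'.
exact: (cvg_trans (near_eq_cvg E) cF).
Unshelve. all: by end_near. Qed.

Lemma speed_affine c a b t : C1_curve c ->
  speed (c \o affine a b) t = `|b| * speed c (affine a b t).
Proof.
move=> [cc dc]; rewrite /speed /=; set i := chart_at _.
have [_ ->] := derive1_affine (dc i (affine a b t) (mem_chart_at _)).1.
rewrite linearZ/= -!scalemxAl -!scalemxAr scalerA mxE sqrtrM ?sqrtr_sqr//.
by rewrite -expr2 sqr_ge0.
Qed.

Definition seg c (a b : R) : \bar R :=
  (\int[lebesgue_measure]_(t in `[a, b]) (speed c t)%:E)%E.

Lemma seg_affine c a b u v : C1_curve c -> 0 < b -> u <= v ->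
  seg (c \o affine a b) u v = seg c (affine a b u) (affine a b v).
Proof.
move=> Cc b0 uv; rewrite /seg.
have D := derive1_affineE a b.
rewrite (@integration_by_substitution_increasing R (affine a b) (speed c) u v)//.
- by apply: eq_integral => t _; rewrite D speed_affine// gtr0_norm// mulrC.
- by move=> x y _ _ xy; rewrite /affine ltrD2l ltr_pM2l.
- by rewrite D => ? _; exact: cvg_cst.
- by rewrite D; exact: is_cvg_cst.
- by rewrite D; exact: is_cvg_cst.
- split.
  + by move=> x _; exact: derivable_affine.
  + by apply: cvg_at_right_filter; exact: affine_continuous.
  + by apply: cvg_at_left_filter; exact: affine_continuous.
- by apply: continuous_subspaceT; exact: C1_speed_continuous.
Qed.

Lemma seg_affine_opp c a b u v : C1_curve c -> b < 0 -> u <= v ->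
  seg (c \o affine a b) u v = seg c (affine a b v) (affine a b u).
Proof.
move=> Cc b0 uv; rewrite /seg.
have D := derive1_affineE a b.
rewrite (@integration_by_substitution_decreasing R (affine a b) (speed c) u v)//.
- by apply: eq_integral => t _; rewrite D speed_affine// ltr0_norm// mulrC.
- by move=> x y _ _ xy; rewrite /affine ltrD2l ltr_nM2l.
- by rewrite D => ? _; exact: cvg_cst.
- by rewrite D; exact: is_cvg_cst.
- by rewrite D; exact: is_cvg_cst.
- split.
  + by move=> x _; exact: derivable_affine.
  + by apply: cvg_at_right_filter; exact: affine_continuous.
  + by apply: cvg_at_left_filter; exact: affine_continuous.
- by apply: continuous_subspaceT; exact: C1_speed_continuous.
Qed.

End reparametrization.

(** * Piecewise C^1 curves and their lengths *)

Section piecewise.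
Variables (R : realType) (n : nat) (M : riemannian_manifold R n).
Implicit Types (c : R -> M) (s : seq R) (l : \bar R).

(** The recursion carries the length [l], computed on the C^1 extensions of the pieces, so that
    gluing, cutting and rescaling are inductions on the breakpoints. [pw_length] identifies [l] with
    the integral of the speed. *)
Fixpoint pw c (a : R) s l : Prop :=
  if s is b :: s' then
    a < b /\ exists c' l', [/\ C1_curve c', {in `[a, b], c =1 c'},
      l = (seg c' a b + l')%E & pw c b s' l']
  else l = 0%E.

Lemma pw_of_pieces c a s : path <%R a s ->
  (forall k, (k < size s)%N -> exists2 c', C1_curve c' &
      {in `[nth 0 (a :: s) k, nth 0 s k], c =1 c'}) ->
  exists l, pw c a s l.
Proof.
elim: s a => [|b s IH] a /=; first by exists 0%E.
move=> /andP[ab pbs] h.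
have [l' hl'] := IH b pbs (fun k ks => h k.+1 ks).
have [c' Cc' cc'] := h 0%N isT.
by exists (seg c' a b + l')%E; split => //; exists c', l'.
Qed.

Lemma pw_path c a s l : pw c a s l -> path <%R a s.
Proof.
elim: s a l => [//=|b s IH] a l /= [ab [c' [l' [_ _ _ h]]]].
by rewrite ab; exact: IH h.
Qed.

Lemma pw_pieces c a s l k : pw c a s l -> (k < size s)%N ->
  exists2 c', C1_curve c' & {in `[nth 0 (a :: s) k, nth 0 s k], c =1 c'}.
Proof.
elim: s a l k => [//=|b s IH] a l [|k] /= [ab [c' [l' [Cc' cc' _ h]]]].
  by move=> _; exists c'.
by rewrite ltnS => ks; exact: IH h ks.
Qed.

Lemma pw_le_last c a s l : pw c a s l -> a <= last a s.
Proof.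
elim: s a l => [//=|b s IH] a l /= [ab [c' [l' [_ _ _ /IH]]]].
exact/le_trans/ltW.
Qed.

Lemma C1_speed_measurable c (D : set R) : C1_curve c -> measurable_fun D (speed c).
Proof.
move=> Cc; apply: measurable_funS (_ : measurable_fun setT (speed c)) => //.
by apply: measurable_realfun.continuous_measurable_fun; exact: C1_speed_continuous.
Qed.

Lemma integral_split (f : R -> R) (a b u : R) : a <= u <= b ->
  (forall t, 0 <= f t) -> measurable_fun `[a, b] f ->
  (\int[lebesgue_measure]_(t in `[a, b]) (f t)%:E =
   \int[lebesgue_measure]_(t in `[a, u]) (f t)%:E +
   \int[lebesgue_measure]_(t in `[u, b]) (f t)%:E)%E.
Proof.
move=> /andP[au ub] f0 mf.
rewrite (@itv_bndbnd_setU _ _ _ (BRight u)) ?bnd_simp//.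
rewrite ge0_integral_setU//=; last 3 first.
- rewrite -itv_bndbnd_setU ?bnd_simp//; exact/measurable_EFinP.
- by move=> x _; rewrite lee_fin.
- by apply: lt_disjoint => x y; rewrite !in_itv/= => /andP[_ xu] /andP[uy _]; exact: le_lt_trans uy.
rewrite integral_itv_obnd_cbnd//; apply/measurable_EFinP.
by apply: measurable_funS mf => //; apply: subset_itv; rewrite bnd_simp.
Qed.

Lemma seg_split c a b u : C1_curve c -> a <= u <= b ->
  (seg c a b = seg c a u + seg c u b)%E.
Proof.
move=> Cc aub; have ms := @C1_speed_measurable c `[a, b]%classic Cc.
exact: (integral_split (f := speed c) aub (speed_ge0 c) ms).
Qed.

(** The interval is open because the derivative at an end point also depends on the values outside
    the interval. *)
Lemma speed_eq c c' (a b t : R) : {in `[a, b], c =1 c'} -> t \in `]a, b[ ->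
  speed c t = speed c' t.
Proof.
move=> cc' tab; have ct : c t = c' t.
  by apply: cc'; exact: subset_itv_oo_cc.
rewrite /speed ct; set i := chart_at _.
have E : \forall s \near t, (chart i \o c) s = (chart i \o c') s.
  have : \forall s \near t, s \in `]a, b[ by exact: near_in_itvoo.
  by apply: filterS => s sab /=; rewrite cc'//; exact: subset_itv_oo_cc.
have -> : derive1 (chart i \o c) t = derive1 (chart i \o c') t.
  rewrite !derive1E; exact: near_eq_derive E.
by [].
Qed.

(** The breakpoints are negligible, so the speeds of the extensions on the open pieces decide both
    measurability and integral. *)
Lemma pw_length c a s l : pw c a s l ->
  measurable_fun `[a, last a s] (speed c) /\ seg c a (last a s) = l.
Proof.
elim: s a l => [|b s IH] a l /=.
  by move=> ->; rewrite /seg set_itv1 integral_set1; split=> //; exact: measurable_fun_set1.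
move=> [ab [c' [l' [Cc' cc' -> h]]]].
have [ms sl] := IH _ _ h; have bl := pw_le_last h.
have mab : measurable_fun `[a, b] (speed c).
  apply: (@measurable_realfun.measurable_fun_itv_cc R a b false true).
  apply: (@eq_measurable_fun _ _ _ _ _ (speed c')); last exact: C1_speed_measurable.
  by move=> t; rewrite inE/= => tab; rewrite (speed_eq cc').
have ma : measurable_fun `[a, last b s] (speed c).
  rewrite (@itv_bndbnd_setU _ _ _ (BRight b)) ?bnd_simp//; last exact: ltW.
  apply/measurable_funU => //; split=> //.
  by apply: measurable_funS ms => //; apply: subset_itv; rewrite bnd_simp.
split=> //.
have e1 : seg c a b = seg c' a b.
  apply: eq_integral_itv_bounded.
  - by apply: measurable_funS mab => //; exact: subset_itv_oo_cc.
  - exact: C1_speed_measurable.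
  - by move=> t tab; exact: speed_eq cc' tab.
have split2 : seg c a (last b s) = (seg c a b + seg c b (last b s))%E.
  have abl : a <= b <= last b s by rewrite (ltW ab).
  exact: (integral_split (f := speed c) abl (speed_ge0 c) ma).
by rewrite split2 e1 sl.
Qed.

Lemma pw_eq c c' a s l : pw c a s l -> {in `[a, last a s], c =1 c'} -> pw c' a s l.
Proof.
elim: s a l => [//=|b s IH] a l /= [ab [c1 [l' [Cc1 cc1 -> h]]]] cc'.
have bl := pw_le_last h.
split=> //; exists c1, l'; split=> //.
  move=> t; rewrite in_itv/= => /andP[a_t tb].
  by rewrite -cc' ?cc1// in_itv/= a_t ?tb ?(le_trans tb).
apply: IH => // t; rewrite in_itv/= => /andP[b_t tl].
by apply: cc'; rewrite in_itv/= tl andbT (le_trans (ltW ab)).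
Qed.

Lemma pw_cat c a s1 s2 l1 l2 : pw c a s1 l1 -> pw c (last a s1) s2 l2 ->
  pw c a (s1 ++ s2) (l1 + l2)%E.
Proof.
elim: s1 a l1 => [|b s IH] a l1 /=; first by move=> ->; rewrite add0e.
move=> [ab [c1 [l' [Cc1 cc1 -> h]]]] h2; split=> //.
exists c1, (l' + l2)%E; split=> //; first by rewrite addeA.
exact: IH.
Qed.

Lemma pw_affine c a s l (u v : R) : 0 < v -> pw c a s l ->
  pw (c \o affine u v) ((a - u) / v) [seq (x - u) / v | x <- s] l.
Proof.
move=> v0; have vE x : affine u v ((x - u) / v) = x.
  by rewrite /affine mulrC divfK ?gt_eqF// addrC subrK.
elim: s a l => [//=|b s IH] a l /= [ab [c1 [l' [Cc1 cc1 -> h]]]].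
have uab : (a - u) / v < (b - u) / v by rewrite ltr_pM2r ?invr_gt0// ltrD2r.
split=> //; exists (c1 \o affine u v), l'; split.
- exact: C1_affine.
- move=> t; rewrite in_itv/= => /andP[at_ tb]; apply: cc1.
  by rewrite in_itv/= -[a]vE -[b]vE /affine !lerD2l !ler_pM2l// at_.
- by rewrite seg_affine// ?vE// ltW.
- exact: IH.
Qed.

Lemma pw_split c a s l u : pw c a s l -> a < u < last a s ->
  exists s1 s2 l1 l2, [/\ pw c a s1 l1, last a s1 = u, pw c u s2 l2,
    last u s2 = last a s & l = (l1 + l2)%E].
Proof.
elim: s a l => [a l _|b s IH a l] /=; first by move=> /andP[/lt_trans h /h]; rewrite ltxx.
move=> [ab [c1 [l' [Cc1 cc1 -> h]]]] /andP[au ul].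
have [ub|bu|ub] := ltgtP u b.
- exists [:: u], (b :: s), (seg c1 a u + 0)%E, (seg c1 u b + l')%E; split=> //=.
  + split=> //; exists c1, 0%E; split=> // t; rewrite in_itv/= => /andP[at_ tu].
    by apply: cc1; rewrite in_itv/= at_ (le_trans tu (ltW ub)).
  + split=> //; exists c1, l'; split=> // t; rewrite in_itv/= => /andP[ut tb].
    by apply: cc1; rewrite in_itv/= tb (le_trans (ltW au) ut).
  + by rewrite adde0 addeA -seg_split// !ltW.
- have [|s1 [s2 [l1 [l2 [h1 e1 h2 e2 ->]]]]] := IH _ _ h; first by rewrite bu.
  exists (b :: s1), s2, (seg c1 a b + l1)%E, l2; split=> //; last by rewrite addeA.
  by split=> //; exists c1, l1.
- exists [:: b], s, (seg c1 a b + 0)%E, l'; rewrite ub; split=> //; last by rewrite adde0.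
  by split=> //; exists c1, 0%E.
Qed.

Lemma pw_continuous c a s l : pw c a s l -> {within `[a, last a s], continuous c}.
Proof.
elim: s a l => [|b s IH] a l /=.
  by move=> _; rewrite set_itv1; exact: continuous_subspace1.
move=> [ab [c1 [l' [Cc1 cc1 _ h]]]]; have bl := pw_le_last h.
have -> : `[a, last b s]%classic = `[a, b] `|` `[b, last b s].
  apply/seteqP; split=> t /=; rewrite !in_itv/=.
    by move=> /andP[-> tl]; have [|/ltW] := leP t b; [left|right; rewrite ?tl andbT].
  move=> [/andP[-> tb]|/andP[bt ->]]; first exact: le_trans tb bl.
  by rewrite andbT (le_trans (ltW ab)).
apply: withinU_continuous; [exact: itv_closed|exact: itv_closed| |exact: IH h].
apply: (@subspace_eq_continuous _ _ _ c1); last by apply: continuous_subspaceT; exact: Cc1.1.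
by move=> t; rewrite inE => tab; exact/esym/cc1.
Qed.

End piecewise.

(** * The Riemannian distance as an extended pseudometric *)

Section riemannian_pseudometric.
Variables (R : realType) (n : nat) (M : riemannian_manifold R n).
Implicit Types (c : R -> M) (p q : M).

Lemma rdist_ge0 p q : (0 <= rdist p q)%E.
Proof.
apply: le_ereal_inf_tmp => _ [c _ <-]; apply: integral_ge0 => t _.
by rewrite lee_fin speed_ge0.
Qed.

Lemma rdist_le_curve c l s : pw c 0 s l -> last 0 s = 1 -> (rdist (c 0%R) (c 1%R) <= l)%E.
Proof.
move=> h s1; apply: ereal_inf_lbound; exists c.
  split=> //; exists s; split=> //; first exact: pw_path h.
  by move=> k ks; exact: pw_pieces h ks.
by have [_ <-] := pw_length h; rewrite s1.
Qed.

Lemma rdist_lt_curve p q (x : \bar R) : (rdist p q < x)%E ->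
  exists c s l, [/\ pw c 0 s l, last 0 s = 1, c 0 = p, c 1 = q & (l < x)%E].
Proof.
move=> /ereal_inf_lt[_ [c [[s [ps s1 hs]] c0 c1] <-]] lx.
have [l h] := pw_of_pieces ps hs.
exists c, s, l; split=> //.
have [_ <-] := pw_length h; rewrite s1; exact: lx.
Qed.

Lemma rdist_le_pw c a s l : pw c a s l -> s != [::] -> (rdist (c a) (c (last a s)) <= l)%E.
Proof.
move=> h sn; set b := last a s.
have ab : 0 < b - a.
  rewrite subr_gt0 /b; case: s h {b} sn => [//|b s] /= [ab [c' [l' [_ _ _ h]]]] _.
  exact: lt_le_trans ab (pw_le_last h).
have h' := pw_affine a ab h; rewrite subrr mul0r in h'.
have e0 : affine a (b - a) 0 = a by rewrite /affine mulr0 addr0.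
have e1 : affine a (b - a) 1 = b by rewrite /affine mulr1 addrC subrK.
have := rdist_le_curve h' _; rewrite /= e0 e1; apply.
have -> : 0 = (a - a) / (b - a) by rewrite subrr mul0r.
by rewrite (last_map (fun x => (x - a) / (b - a))) divff// gt_eqF.
Qed.

Lemma C1_cst p : C1_curve (fun _ : R => p).
Proof.
split; first exact: cst_continuous.
move=> i t it; have -> : chart i \o (fun=> p) = cst (chart i p) by [].
split; first exact: derivable_cst.
have -> : derive1 (cst (chart i p) : R -> 'rV[R]_n) = cst 0.
  by apply/funext => s; rewrite derive1E derive_cst.
exact: cst_continuous.
Qed.

Lemma rdist_xx p : rdist p p = 0%E.
Proof.
apply/eqP; rewrite eq_le rdist_ge0 andbT.
have h : pw (fun=> p) 0 [:: 1 : R] (seg (fun=> p) 0 1 + 0)%E.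
  by split=> //; exists (fun=> p), 0%E; split=> //; exact: C1_cst.
have := rdist_le_curve h erefl; rewrite adde0 => /le_trans; apply.
rewrite /seg integral0_eq// => t _; rewrite /speed.
have -> : derive1 (chart (chart_at p) \o (fun=> p)) t = 0 :> 'rV[R]_n.
  by rewrite derive1E derive_cst.
by rewrite !mul0mx mxE sqrtr0.
Qed.

Lemma rdist_triangle p q r : (rdist p r <= rdist p q + rdist q r)%E.
Proof.
have [->|pq] := eqVneq (rdist p q) +oo%E; first by rewrite addye ?leey// gt_eqF// (lt_le_trans _ (rdist_ge0 _ _)).
have [->|qr] := eqVneq (rdist q r) +oo%E; first by rewrite addey ?leey// gt_eqF// (lt_le_trans _ (rdist_ge0 _ _)).
have fpq : rdist p q \is a fin_num by rewrite ge0_fin_numE ?rdist_ge0// ltey.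
have fqr : rdist q r \is a fin_num by rewrite ge0_fin_numE ?rdist_ge0// ltey.
apply/lee_addgt0Pr => e e0.
have e20 : 0 < e / 2 by rewrite divr_gt0.
have [|c1 [s1 [l1 [h1 e1 c10 c11 l1e]]]] := @rdist_lt_curve p q (rdist p q + (e / 2)%:E).
  by rewrite lteDl// lte_fin.
have [|c2 [s2 [l2 [h2 e2 c20 c21 l2e]]]] := @rdist_lt_curve q r (rdist q r + (e / 2)%:E).
  by rewrite lteDl// lte_fin.
(* [c2] is shifted to [1, 2], and [rdist_le_pw] rescales the concatenation to [0, 1]. *)
pose c t := if t <= 1 then c1 t else c2 (affine (-1) 1 t).
have hc1 : pw c 0 s1 l1.
  apply: (pw_eq h1) => t; rewrite e1 in_itv/= => /andP[_ t1].
  by rewrite /c t1.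
have a1 x : (x - -1) / 1 = x + 1 :> R by rewrite divr1 opprK.
have h2' := pw_affine (-1) (@ltr01 R) h2; rewrite a1 add0r in h2'.
have ell : last 1 [seq (x - -1) / 1 | x <- s2] = 2.
  by have := last_map (fun x : R => (x - -1) / 1) s2 0; rewrite e2 !a1 add0r.
have hc2 : pw c 1 [seq (x - -1) / 1 | x <- s2] l2.
  apply: (pw_eq h2') => t; rewrite ell in_itv/= => /andP[t1 _].
  rewrite /c; case: leP => // t1'.
  have -> : t = 1 by apply/eqP; rewrite eq_le t1'.
  by rewrite c11 /= /affine mulr1 addNr c20.
rewrite -[X in pw _ X _ _]e1 in hc2.
have := rdist_le_pw (pw_cat hc1 hc2); rewrite last_cat e1 ell.
have -> : c 0 = p by rewrite /c ler01.
have -> : c 2 = r.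
  rewrite /c leNgt ltr1n/= /affine -c21; congr c2; ring.
move=> H; apply: (le_trans (H _)).
  by case: s1 e1 {h1 hc1 hc2 H} => //= e1; rewrite -e1 in ell; move/eqP : e1; rewrite eq_sym oner_eq0.
rewrite [e]splitr EFinD addeACA; apply: leeD; exact: ltW.
Qed.

(** Each piece is reversed separately and the triangle inequality joins them, which avoids reversing
    the list of breakpoints. *)
Lemma rdist_pw_sym c a s l : pw c a s l -> (rdist (c (last a s)) (c a) <= l)%E.
Proof.
elim: s a l => [|b s IH] a l /=; first by move=> ->; rewrite rdist_xx.
move=> [ab [c' [l' [Cc' cc' -> h]]]].
apply: (le_trans (rdist_triangle _ (c b) _)); rewrite addeC; apply: leeD; last exact: IH.
have h' : pw (c' \o affine (a + b) (-1)) a [:: b]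
    (seg (c' \o affine (a + b) (-1)) a b + 0)%E.
  split=> //; exists (c' \o affine (a + b) (-1)), 0%E; split=> //.
  exact: C1_affine.
have := rdist_le_pw h' isT; rewrite adde0 seg_affine_opp ?(ltW ab)// ?oppr_lt0//.
have ea : affine (a + b) (-1) a = b by rewrite /affine mulN1r addrAC subrr add0r.
have eb : affine (a + b) (-1) b = a by rewrite /affine mulN1r addrK.
rewrite /comp/= ?ea ?eb.
by rewrite (cc' a) ?(cc' b) ?in_itv/= ?lexx ?(ltW ab).
Qed.

Lemma rdist_sym p q : rdist p q = rdist q p.
Proof.
wlog suff : p q / (rdist p q <= rdist q p)%E.
  by move=> H; apply/eqP; rewrite eq_le !H.
rewrite leNgt; apply/negP => /rdist_lt_curve[c [s [l [h s1 c0 c1 lp]]]].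
have := rdist_pw_sym h; rewrite s1 c0 c1 => /le_lt_trans /(_ lp).
by rewrite ltxx.
Qed.

Lemma clamp_continuous (T : topologicalType) (c : R -> T) :
  {within `[0, 1], continuous c} ->
  continuous (fun t : R => c (Num.min 1 (Num.max 0 t))).
Proof.
move=> cc t; pose h (t : R) := Num.min 1 (Num.max 0 t).
have h01 s : `[0, 1]%classic (h s).
  rewrite /= in_itv/= /h le_min ler01/= ge_min lexx orTb andbT.
  by rewrite le_max lexx.
have ch : continuous h.
  move=> s; apply: (@continuous_min R R (cst 1) (fun s => Num.max 0 s)).
    exact: cst_continuous.
  by apply: (@continuous_max R R (cst 0) id); [exact: cst_continuous|exact: cvg_id].
move/subspace_continuousP : cc => /(_ (h t) (h01 t)) cc.
move=> B /cc; rewrite /within/= => /(ch t).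
rewrite /= => H; have H' : \forall s \near t, `[0, 1]%classic (h s) -> B (c (h s)) by exact: H.
suff : \forall s \near t, B (c (h s)) by [].
by apply: filterS H' => s; apply; exact: h01.
Qed.

(** This is the form in which nearly minimizing curves are used later: cutting the curve at [t]
    bounds the two distances by the lengths of the two parts. Clamping the parameter to [0, 1]
    extends the curve continuously to the line. *)
Lemma rdist_path p q (x : \bar R) : (rdist p q < x)%E ->
  exists g : R -> M, [/\ continuous g, g 0 = p, g 1 = q &
    forall t, (rdist p (g t) + rdist (g t) q < x)%E].
Proof.
move=> /rdist_lt_curve[c [s [l [h s1 c0 c1 lx]]]].
have cc := pw_continuous h; rewrite s1 in cc.
exists (fun t : R => c (Num.min 1 (Num.max 0 t))); split.
- exact: clamp_continuous.
- by rewrite maxxx (min_idPr _) ?ler01.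
- by rewrite (max_idPr _) ?ler01// minxx.
move=> t; set u := Num.min 1 _.
have u01 : 0 <= u <= 1 by rewrite /u le_min ler01/= le_max lexx/= ge_min lexx.
have hpq : (rdist p q <= l)%E by rewrite -c0 -c1; exact: rdist_le_curve h s1.
have [u0|un0] := eqVneq u 0.
  by rewrite u0 c0 rdist_xx add0e (le_lt_trans hpq).
have [u1|un1] := eqVneq u 1.
  by rewrite u1 c1 rdist_xx adde0 (le_lt_trans hpq).
have [|t1 [t2 [l1 [l2 [h1 e1 h2 e2 le]]]]] := @pw_split _ _ _ _ _ _ _ u h.
  by rewrite s1 !lt_neqAle eq_sym un0 un1.
have t1n : t1 != [::] by apply: contra_neq un0 => t10; rewrite -e1 t10.
have t2n : t2 != [::] by apply: contra_neq un1 => t20; rewrite -s1 -e2 t20.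
have r1 := rdist_le_pw h1 t1n; have r2 := rdist_le_pw h2 t2n.
rewrite e1 c0 in r1; rewrite e2 s1 c1 in r2.
by apply: le_lt_trans lx; rewrite le; exact: leeD.
Qed.

End riemannian_pseudometric.

(** * Short paths inside a chart *)

Section local_structure.
Variables (R : realType) (n : nat) (M : riemannian_manifold R n).

(** The norms are maxima of entries, hence one factor [n] for each of the two sums. *)
Lemma quadratic_form_bound (G : 'M[R]_n) (v : 'rV[R]_n) :
  `|(v *m G *m v^T) 0 0| <= n%:R ^+ 2 * `|G| * `|v| ^+ 2.
Proof.
have h1 b : `|(v *m G) 0 b| <= n%:R * (`|v| * `|G|).
  rewrite mxE (le_trans (ler_norm_sum _ _ _))//.
  apply: (@le_trans _ _ (\sum_(a < n) `|v| * `|G|)).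
    by apply: ler_sum => a _; rewrite normrM ler_pM ?le_mx_norm.
  by rewrite sumr_const card_ord mulr_natl.
rewrite mxE (le_trans (ler_norm_sum _ _ _))//.
apply: (@le_trans _ _ (\sum_(a < n) n%:R * (`|v| * `|G|) * `|v|)).
  by apply: ler_sum => a _; rewrite normrM [v^T _ _]mxE ler_pM ?le_mx_norm.
rewrite sumr_const card_ord -mulr_natl le_eqVlt; apply/orP; left; apply/eqP; ring.
Qed.

(* A smooth step from 0 to 1: the segments of a chart are reparametrized by it
   because the pieces of a curve extend to the whole line. *)
Definition ramp (t : R) : R := (1 - cos (affine 0 pi t)) / 2.

Lemma ramp_ge0 t : 0 <= ramp t.
Proof. by rewrite divr_ge0// subr_ge0 cos_le1. Qed.

Lemma ramp_le1 t : ramp t <= 1.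
Proof. by rewrite /ramp; have := cos_geN1 (affine 0 pi t); lra. Qed.

Lemma ramp0 : ramp 0 = 0.
Proof. by rewrite /ramp /affine mulr0 addr0 cos0 subrr mul0r. Qed.

Lemma ramp1 : ramp 1 = 1.
Proof. by rewrite /ramp /affine mulr1 add0r cospi opprK divff. Qed.

Lemma is_derive_ramp (t : R) : is_derive t 1 ramp (pi / 2 * sin (affine 0 pi t)).
Proof.
have dc : derivable (@cos R) (affine 0 pi t) 1 by exact: derivable_cos.
have [d1 d2] := derive1_affine dc.
have dcos : is_derive t 1 ((@cos R) \o affine 0 pi) (- (pi * sin (affine 0 pi t))).
  apply: DeriveDef; first exact: d1.
  by rewrite -derive1E d2 derive1E (@derive_val _ _ _ _ _ _ _ (is_derive_cos _)) -mulrN.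
have -> : ramp = (2^-1) \*: (cst 1 - ((@cos R) \o affine 0 pi)).
  by apply/funext => s; rewrite /ramp /= mulrC.
have D : is_derive t 1 (2^-1 \*: (cst 1 - ((@cos R) \o affine 0 pi)) : R -> R)
   (2^-1 *: (0 - - (pi * sin (affine 0 pi t)))) by exact: is_deriveZ.
suff -> : pi / 2 * sin (affine 0 pi t) = 2^-1 *: (0 - - (pi * sin (affine 0 pi t))) by [].
by rewrite sub0r opprK /GRing.scale/=; ring.
Qed.

Lemma derive1_ramp : derive1 ramp = fun t => pi / 2 * sin (affine 0 pi t).
Proof. by apply/funext => t; rewrite derive1E; have [] := is_derive_ramp t. Qed.

Lemma continuous_derive1_ramp : continuous (derive1 ramp).
Proof.
rewrite derive1_ramp => t; apply: cvgM; first exact: cvg_cst.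
by apply: continuous_comp; [exact: affine_continuous|exact: continuous_sin].
Qed.

Lemma derive1_ramp_le t : `|derive1 ramp t| <= pi.
Proof.
rewrite derive1_ramp normrM; have p0 : 0 <= pi :> R by exact: pi_ge0.
have s1 : `|sin (affine 0 pi t)| <= 1 by rewrite ler_norml sin_geN1 sin_le1.
rewrite ger0_norm ?divr_ge0// (@le_trans _ _ (pi / 2))// ?ler_piMr ?divr_ge0//.
lra.
Qed.

Definition ramp_line (x w : 'rV[R]_n) (t : R) : 'rV[R]_n := x + ramp t *: w.

Lemma ramp_line_derivable x w t : derivable (ramp_line x w) t 1 /\
  derive1 (ramp_line x w) t = derive1 ramp t *: w.
Proof.
have dr : differentiable ramp t.
  by apply/derivable1_diffP; have [] := is_derive_ramp t.
have dz : differentiable (fun s => ramp s *: w) t by exact: differentiableZl.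
have hz : is_derive t 1 (fun s => ramp s *: w) (derive1 ramp t *: w).
  apply: DeriveDef; first exact/derivable1_diffP.
  by rewrite -derive1E (derive1E' dz) (derive1E' dr) diffZl.
have [h1 h2] : is_derive t 1 (cst x + (fun s => ramp s *: w)) (0 + derive1 ramp t *: w).
  exact: is_deriveD.
by split; [exact: h1|rewrite derive1E; apply: etrans h2 _; rewrite add0r].
Qed.

Lemma ramp_line_continuous x w : continuous (ramp_line x w).
Proof.
move=> t; apply: differentiable_continuous; apply/derivable1_diffP.
exact: (ramp_line_derivable x w t).1.
Qed.

End local_structure.

Section local_paths.
Variables (R : realType) (n : nat) (M : riemannian_manifold R n).
Implicit Types (i : chart_index M) (p q : M).

Definition chart_line i (x w : 'rV[R]_n) (t : R) : M := chart_inv i (ramp_line x w t).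

Lemma chart_lineP i (x w : 'rV[R]_n) (K : R) :
  (forall t : R, 0 <= t <= 1 -> (chart i @` dom i) (x + t *: w) /\ `|metric i (x + t *: w)| <= K) ->
  [/\ C1_curve (chart_line i x w),
      chart_line i x w 0 = chart_inv i x,
      chart_line i x w 1 = chart_inv i (x + w) &
      forall t, speed (chart_line i x w) t <= Num.sqrt (n%:R ^+ 2 * K) * (pi * `|w|)].
Proof.
move=> h; set c := chart_line i x w.
have r01 (t : R) : 0 <= ramp t <= 1 by rewrite ramp_ge0 ramp_le1.
have imx t : (chart i @` dom i) (ramp_line x w t) by have [] := h _ (r01 t).
have domc t : dom i (c t).
  by have [q iq e] := imx t; rewrite /c /chart_line -e chartK.
have chartc : chart i \o c = ramp_line x w.
  apply/funext => t; have [q iq e] := imx t.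
  by rewrite /= /c /chart_line -e chartK.
have cc : continuous c.
  move=> t; apply: continuous_comp; first exact: ramp_line_continuous.
  exact: chart_inv_cvg (imx t).
have dc t : derivable (chart i \o c) t 1.
  by rewrite chartc; exact: (ramp_line_derivable x w t).1.
have d1c : derive1 (chart i \o c) = fun t => derive1 (@ramp R) t *: w.
  by apply/funext => t; rewrite chartc; exact: (ramp_line_derivable x w t).2.
have Cc : C1_curve c.
  apply: C1_curve_chart => // t; exists i; split; [exact: domc|exact: dc|split].
    rewrite d1c; have cr : derive1 (@ramp R) s @[s --> t] --> derive1 (@ramp R) t.
      exact: continuous_derive1_ramp.
    apply: (@cvg_mx R 1 n R (nbhs t) _) => a b.
    rewrite mxE; under eq_cvg do rewrite mxE.
    exact: (cvgM cr (cvg_cst _)).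
  exact: (@filterE R (nbhs t) _ _ dc).
split=> //.
- by rewrite /c /chart_line /ramp_line ramp0 scale0r addr0.
- by rewrite /c /chart_line /ramp_line ramp1 scale1r.
move=> t; rewrite (speed_chart (cc t) (domc t) (dc t)) /speed_in.
have chct : chart i (c t) = ramp_line x w t by rewrite -chartc.
have [_ GK] := h _ (r01 t); rewrite -/(ramp_line x w t) -chct in GK.
have K0 : 0 <= K by exact: le_trans GK.
have dw : `|derive1 (chart i \o c) t| <= pi * `|w|.
  by rewrite d1c normrZ ler_wpM2r// derive1_ramp_le.
set v := derive1 (chart i \o c) t in dw *.
have -> : pi * `|w| = Num.sqrt ((pi * `|w|) ^+ 2).
  by rewrite sqrtr_sqr ger0_norm// mulr_ge0// pi_ge0.
rewrite -sqrtrM; last by rewrite mulr_ge0// sqr_ge0.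
apply: ler_wsqrtr; apply: (le_trans (ler_norm _)).
apply: (le_trans (quadratic_form_bound _ _)).
apply: ler_pM.
- by rewrite mulr_ge0// sqr_ge0.
- by rewrite sqr_ge0.
- by rewrite ler_wpM2l// sqr_ge0.
- by rewrite ler_pXn2r// nnegrE// mulr_ge0// pi_ge0.
Qed.

Lemma seg_le (c : R -> M) (C : R) : C1_curve c -> 0 <= C -> (forall t, speed c t <= C) ->
  (seg c 0 1 <= C%:E)%E.
Proof.
move=> Cc C0 h; have -> : C%:E = (\int[lebesgue_measure]_(t in `[0%R, 1%R]) (cst C%:E t))%E.
  by rewrite integral_cst//= lebesgue_measure_itv/= lte_fin ltr01 oppr0 adde0 mule1.
apply: ge0_le_integral => //.
- by move=> t _; rewrite lee_fin speed_ge0.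
- by apply/measurable_EFinP; exact: C1_speed_measurable.
- by move=> t _; rewrite lee_fin.
Qed.

(** Straight segments in the chart at [p]: the metric is bounded near [p], so a short segment has
    small length, and it stays in [U]. *)
Lemma local_paths p (U : set M) (e : R) : nbhs p U -> 0 < e ->
  \forall q \near p, (rdist p q < e%:E)%E /\
    exists g : R -> M, [/\ continuous g, g 0 = p, g 1 = q & forall t, U (g t)].
Proof.
move=> Up e0; pose i := chart_at p; have ip : dom i p := mem_chart_at p.
set x := chart i p.
have ix : (chart i @` dom i) x by exists p.
pose K := `|metric i x| + 1.
have [d d0 hd] : exists2 d : R, 0 < d & forall y, `|x - y| < d ->
    [/\ (chart i @` dom i) y, U (chart_inv i y) & `|metric i y| <= K].
  have : \forall y \near x, [/\ (chart i @` dom i) y, U (chart_inv i y) & `|metric i y| <= K].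
    have n1 : \forall y \near x, (chart i @` dom i) y.
      exact: open_nbhs_nbhs (conj (@chart_image_open _ _ M i) ix).
    have n2 : \forall y \near x, U (chart_inv i y).
      by apply: (chart_inv_cvg ix); rewrite chartK.
    have cG : metric i y @[y --> x] --> metric i x.
      apply: (@cvg_mx R n n 'rV[R]_n (nbhs x) _ (metric i) (metric i x)) => a b; have [+ _] := metric_smooth i a b 0%N; apply; exact: ix.
    have n3 : \forall y \near x, `|metric i x - metric i y| < 1.
      by move/cvgrPdist_lt : cG; apply.
    near=> y; split; [by near: y|by near: y|].
    rewrite -[metric i y](subrK (metric i x)) addrC (le_trans (ler_normD _ _))// lerD2l.
    by rewrite distrC ltW//; near: y.
  by move=> /nbhs_normP[d d0 hd]; exists d => // y xy; exact: hd.
pose C := Num.sqrt (n%:R ^+ 2 * K) * pi.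
have C0 : 0 <= C by rewrite mulr_ge0// ?sqrtr_ge0// pi_ge0.
(* [C] is 0 when [n = 0], hence the denominator [C + 1]. *)
have e10 : 0 < e / (C + 1) by rewrite divr_gt0// ltr_wpDl.
have n1 : \forall q \near p, dom i q.
  exact: open_nbhs_nbhs (conj (@dom_open _ _ M i) ip).
have n2 : \forall q \near p, `|x - chart i q| < Num.min d (e / (C + 1)).
  by move/cvgrPdist_lt : (chart_cvg ip); apply; rewrite lt_min d0.
near=> q; have iq : dom i q by near: q.
have : `|x - chart i q| < Num.min d (e / (C + 1)) by near: q.
rewrite lt_min => /andP[qd qe].
pose w := chart i q - x.
have wd t : 0 <= t <= 1 -> `|x - (x + t *: w)| < d.
  move=> /andP[t0 t1]; rewrite opprD addNKr normrN normrZ ger0_norm//.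
  by rewrite distrC in qd; apply: le_lt_trans qd; rewrite ler_piMl.
have [|Cc c0 c1 cs] := @chart_lineP i x w K.
  by move=> t t01; have [] := hd _ (wd t t01).
have xw : x + w = chart i q by rewrite addrC subrK.
rewrite xw chartK// in c1; rewrite chartK// in c0.
split.
  have h : pw (chart_line i x w) 0 [:: 1 : R] (seg (chart_line i x w) 0 1 + 0)%E.
    by split=> //; exists (chart_line i x w), 0%E; split.
  have := rdist_le_curve h erefl; rewrite c0 c1 adde0 => /le_lt_trans; apply.
  apply: (@le_lt_trans _ _ (C * `|w|)%:E).
    apply: seg_le => //; first by rewrite mulr_ge0.
    by move=> t; rewrite /C -mulrA.
  rewrite lte_fin; rewrite distrC -/w in qe.
  move: qe; rewrite ltr_pdivlMr ?ltr_wpDl// mulrDr mulr1 mulrC => qe.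
  by apply: le_lt_trans qe; rewrite lerDl.
exists (chart_line i x w); split=> //; first exact: Cc.1.
move=> t; have r01 : 0 <= ramp t <= 1 by rewrite ramp_ge0 ramp_le1.
by have [] := hd _ (wd _ r01).
Unshelve. all: by end_near. Qed.

End local_paths.

(** * Separation in one-dimensional complexes *)

Lemma cvg_ptws (R : realType) (V : choiceType) (T : Type) (F : set_system T)
    (FF : Filter F) (h : T -> V -> R) (l : V -> R) :
  (forall v, h x v @[x --> F] --> l v) -> (h : T -> {ptws V -> R}) @ F --> (l : {ptws V -> R}).
Proof.
move=> hv; apply/cvg_sup => v U [_ [[W oW <-] Wl] WU].
have : \forall x \near F, W (h x v) by exact: (hv v W (open_nbhs_nbhs (conj oW Wl))).
by apply: filterS => x Wx; exact: WU.
Qed.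

Section realization_lemmas.
Variables (R : realType) (V : choiceType) (K : simplicial_complex V).
Local Notation X := (realization R K).

Lemma realization_eq (x y : X) : (forall v, x v = y v) -> x = y.
Proof.
case: x y => [x hx] [y hy] /= /funext xy; rewrite xy in hx *.
by congr Realization; exact: Prop_irrelevance.
Qed.

Lemma open_realization (U : set X) :
  (forall s, faces K s -> exists2 O : set {ptws V -> R}, open O &
    forall x : X, simplex_of s x -> (U x <-> O (x : V -> R))) -> open U.
Proof. by []. Qed.

Lemma realization_openP (U : set X) s : open U -> faces K s ->
  exists2 O : set {ptws V -> R}, open O &
    forall x : X, simplex_of s x -> (U x <-> O (x : V -> R)).
Proof. by move=> oU; apply: oU. Qed.

Lemma barycentric_continuous v : continuous (fun x : X => x v).
Proof.
apply/continuousP => B oB; apply: open_realization => s Ks.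
exists [set f : {ptws V -> R} | B (f v)] => //.
by apply: open_comp oB => f _; exact: (@proj_continuous V (fun=> R) v).
Qed.

Lemma realization_hausdorff : hausdorff_space X.
Proof.
move=> x y xy; apply: realization_eq => v.
apply: (@Rhausdorff R) => A B Ax By.
have [z [Az Bz]] := xy _ _ (barycentric_continuous Ax) (barycentric_continuous By).
by exists (z v).
Qed.

Lemma simplex_of_ge0 s (x : X) v : simplex_of s x -> 0 <= x v.
Proof. by case. Qed.

Definition edge_point (v w : V) (t : R) : V -> R :=
  fun u => if u == v then t else if u == w then 1 - t else 0.

Lemma edge_point_continuous v w :
  continuous (edge_point v w : R -> {ptws V -> R}).
Proof.
move=> t; apply: cvg_ptws => u /=.
rewrite /edge_point; case: eqP => _; first exact: cvg_id.
case: eqP => _; last exact: cvg_cst.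
by apply: cvgB; [exact: cvg_cst|exact: cvg_id].
Qed.

Lemma edge_point_simplex v w t : v != w -> 0 <= t <= 1 ->
  simplex_of [fset v; w]%fset (edge_point v w t).
Proof.
move=> vw /andP[t0 t1]; split=> [u|u|].
- by rewrite /edge_point; case: ifP => // _; case: ifP => // _; rewrite subr_ge0.
- by rewrite !inE negb_or /edge_point => /andP[/negbTE -> /negbTE ->].
- rewrite big_fsetU1 ?inE//= big_seq_fset1 /edge_point eqxx.
  by rewrite eq_sym (negbTE vw) eqxx addrC subrK.
Qed.

Lemma simplex_edge v w (x : V -> R) : v != w -> simplex_of [fset v; w]%fset x ->
  x = edge_point v w (x v) /\ 0 <= x v <= 1.
Proof.
move=> vw [x0 xs x1]; rewrite big_fsetU1 ?inE//= big_seq_fset1 in x1.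
have xw : x w = 1 - x v by rewrite -x1 [x v + _]addrC addrK.
split; last by rewrite x0 -subr_ge0 -xw x0.
apply/funext => u; rewrite /edge_point.
have [->//|uv] := eqVneq u v; have [->//|uw] := eqVneq u w.
by apply: xs; rewrite !inE negb_or uv.
Qed.

Definition trace (v w : V) (A : set X) : set R :=
  [set t | exists x : X, [/\ A x, simplex_of [fset v; w]%fset x & x v = t]].

Lemma trace_closed v w (A : set X) (t : R) : v != w -> faces K [fset v; w]%fset ->
  closed A -> 0 <= t <= 1 -> ~ trace v w A t ->
  exists2 U : set R, nbhs t U & forall u, U u -> ~ trace v w A u.
Proof.
move=> vw Kvw cA t01 nAt.
have [W oW hW] := realization_openP (closed_openC cA) Kvw.
have ept := edge_point_simplex vw t01.
have Oet : W (edge_point v w t).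
  pose x := Realization (ex_intro2 _ _ _ Kvw ept).
  have [h _] := hW x ept; apply: h => Ax; apply: nAt; exists x; split => //.
  by rewrite /= /edge_point eqxx.
exists [set u | W (edge_point v w u)].
  exact: (edge_point_continuous (open_nbhs_nbhs (conj oW Oet))).
move=> u Ou [x [Ax sx xu]]; have [e _] := simplex_edge vw sx.
by have [_ h] := hW x sx; apply: h Ax; rewrite e xu.
Qed.

(* Two points of [s] lie in a common cell of size [1/N]: the conclusion says that
   no cell meets both sets, and that the cells at a vertex off [A1] miss [A1]. *)
Lemma fine_grid v w (A1 A2 : set X) : v != w -> faces K [fset v; w]%fset ->
  closed A1 -> closed A2 -> A1 `&` A2 = set0 ->
  exists N0 : nat, forall N, (N0 <= N)%N ->
    (forall x z : X, simplex_of [fset v; w]%fset x -> simplex_of [fset v; w]%fset z ->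
      A1 z -> A2 x -> `|x v - z v| > N.+1%:R^-1) /\
    (forall u t, ((u == v) && (t == 1)) || ((u == w) && (t == 0)) ->
      (forall z : X, z u = 1 -> ~ A1 z) ->
      forall z : X, simplex_of [fset v; w]%fset z -> A1 z -> `|t - z v| > 2 / N.+1%:R).
Proof.
move=> vw Kvw c1 c2 A12.
have [|A B AB|t t01|d d0 hd] := @lebesgue_number R R `[0, 1]%classic
    (fun W : set R => (forall t, W t -> ~ trace v w A1 t) \/
                      (forall t, W t -> ~ trace v w A2 t)).
- exact: segment_compact.
- by move=> [h|h]; [left|right] => t At; apply: h; exact: AB.
- have {}t01 : 0 <= t <= 1 by move: t01; rewrite /= in_itv.
  have [T1|/(trace_closed vw Kvw c1 t01)[U Ut hU]] := pselect (trace v w A1 t); last first.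
    by exists U => //; left.
  have T2 : ~ trace v w A2 t.
    move: T1 => [x [Ax sx xt]] [y [Ay sy yt]].
    have xy : x = y.
      apply: realization_eq => u.
      have [-> _] := simplex_edge vw sx; have [-> _] := simplex_edge vw sy.
      by rewrite xt yt.
    suff : (A1 `&` A2) x by rewrite A12.
    by split=> //; rewrite xy.
  have [U Ut hU] := trace_closed vw Kvw c2 t01 T2.
  by exists U => //; right.
have apart t : 0 <= t <= 1 -> exists2 e : R, 0 < e & ~ trace v w A1 t ->
    forall z : X, simplex_of [fset v; w]%fset z -> A1 z -> e <= `|t - z v|.
  move=> t01; have [T1|/[dup] nT /(trace_closed vw Kvw c1 t01)[U Ut hU]] := pselect (trace v w A1 t).
    by exists 1.
  have [e /= e0 eU] := (nbhs_ballP _ _).1 Ut.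
  exists e => // _ z sz A1z; rewrite leNgt; apply/negP => tz.
  by apply: (hU (z v)); [exact: eU|exists z].
have [|e1 e10 h1] := apart 1; first by rewrite ler01 lexx.
have [|e2 e20 h2] := apart 0; first by rewrite ler01 lexx.
have [N0 hN0] : exists N : nat, N.+1%:R^-1 < Num.min d (Num.min (e1 / 2) (e2 / 2)).
  by apply: natSinv_lt; rewrite !lt_min d0 !divr_gt0.
exists N0 => N N0N.
have : N.+1%:R^-1 < Num.min d (Num.min (e1 / 2) (e2 / 2)).
  by apply: le_lt_trans hN0; rewrite lef_pV2 ?posrE// ler_nat.
rewrite !lt_min => /and3P[Nd Ne1 Ne2].
split=> [x z sx sz A1z A2x|u t].
  apply: lt_le_trans Nd _; rewrite leNgt; apply/negP => xz.
  have [_ xv01] := simplex_edge vw sx.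
  have [|h|h] := hd (x v); first by rewrite /= in_itv.
    by apply: (h (z v)); [exact: xz|exists z].
  by apply: (h (x v)); [exact: ballxx|exists x].
move=> /orP[/andP[/eqP -> /eqP ->]|/andP[/eqP -> /eqP ->]] nA z sz A1z.
  apply: (@lt_le_trans _ _ e1); first by rewrite mulrC -ltr_pdivlMr.
  by apply: h1 => // -[y [A1y sy /nA]].
apply: (@lt_le_trans _ _ e2); first by rewrite mulrC -ltr_pdivlMr.
apply: h2 => // -[y [A1y sy yv]]; apply: (nA y) => //.
have [-> _] := simplex_edge vw sy.
by rewrite yv /edge_point eq_sym (negbTE vw) eqxx subr0.
Qed.

End realization_lemmas.

(** * Coloring a graph by the cells of a subdivision *)

Section grid_coloring.
Variables (R : realType) (V : choiceType) (K : simplicial_complex V).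
Local Notation X := (realization R K).
Hypothesis dimK : dim_le 1 K.

Lemma vertex_zero (z : X) u v : z u = 1 -> v != u -> z v = 0.
Proof.
move=> zu vu; have [s Ks [z0 zs z1]] := barycentricP z.
have [vs|/zs//] := boolP (v \in s).
have [us|us] := boolP (u \in s); last by move: (zs u us); rewrite zu => /eqP; rewrite oner_eq0.
move: z1; rewrite (big_fsetD1 u us)/= (big_fsetD1 v) ?inE ?vu//= zu => z1.
have S0 : 0 <= \sum_(i <- ((s `\ u) `\ v)%fset) z i by exact: sumr_ge0.
by apply/eqP; rewrite eq_le z0 andbT; move: z1 S0; lra.
Qed.

Lemma vertex_unique (x y : X) u : x u = 1 -> y u = 1 -> x = y.
Proof.
move=> xu yu; apply: realization_eq => v; have [->|vu] := eqVneq v u; first by rewrite xu.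
by rewrite !(vertex_zero _ vu).
Qed.

Lemma vertex_simplex (x : X) u s : x u = 1 -> u \in s -> simplex_of s x.
Proof.
move=> xu us; have [t _ [x0 _ _]] := barycentricP x.
have xv v : v != u -> x v = 0 by exact: vertex_zero.
split=> // [v vs|].
  by apply: xv; apply: contraNneq vs => ->.
rewrite (big_fsetD1 u us)/= xu big1_seq ?addr0// => v /=.
by rewrite !inE => /andP[vu _]; exact: xv.
Qed.

Lemma support_mem (x : X) s u : simplex_of s x -> 0 < x u -> u \in s.
Proof. by move=> [_ xs _] xu; apply: contraTT xu => /xs ->; rewrite ltxx. Qed.

Lemma edge_eq (v w : V) s : v != w -> faces K s -> v \in s -> w \in s ->
  s = [fset v; w]%fset.
Proof.
move=> vw Ks vs ws; apply/esym/eqP; rewrite eqEfcard.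
rewrite cardfs2 vw (dimK Ks) andbT.
by apply/fsubsetP => u; rewrite !inE => /orP[] /eqP ->.
Qed.

Variable o : {fset V} -> V * V.
Hypothesis oP : forall s, faces K s -> #|` s| = 2%N ->
  s = [fset (o s).1; (o s).2]%fset /\ (o s).1 != (o s).2.

Lemma card1_vertex (x : X) s : faces K s -> #|` s| <> 2%N -> simplex_of s x ->
  exists2 u, s = [fset u]%fset & x u = 1.
Proof.
move=> Ks s2 [_ _ x1]; have := dimK Ks; rewrite leq_eqVlt => /predU1P[//|].
rewrite ltnS leq_eqVlt ltnS leqn0 => /orP[/cardfs1P[u su]|].
  by exists u => //; move: x1; rewrite su big_seq_fset1.
by rewrite cardfs_eq0 (negbTE (faces_neq0 Ks)).
Qed.

Variables (A1 A2 : set X) (N : {fset V} -> nat) (th : R).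
Hypothesis A12 : A1 `&` A2 = set0.
Hypothesis N_apart : forall s, faces K s -> #|` s| = 2%N ->
  forall x z : X, simplex_of s x -> simplex_of s z ->
    A1 z -> A2 x -> `|x (o s).1 - z (o s).1| > (N s).+1%:R^-1.
Hypothesis N_vertex : forall s, faces K s -> #|` s| = 2%N ->
  forall u t, ((u == (o s).1) && (t == 1)) || ((u == (o s).2) && (t == 0)) ->
    (forall z : X, z u = 1 -> ~ A1 z) ->
    forall z : X, simplex_of s z -> A1 z -> `|t - z (o s).1| > 2 / (N s).+1%:R.
Hypothesis thP : th = 0 \/ th = 1 / 2.

(** In this scale the nodes of the subdivision of an edge are the integers, and [th] shifts them by
    nothing or by half a cell. The fineness [N] depends on the edge, since there may be infinitely
    many edges. *)
Definition height s (x : X) : R := (N s).+1%:R * x (o s).1 + th.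

(** Not symmetric: [x] determines one half-open cell through the floor, and [z] ranges over the
    closure of that cell. *)
Definition same_cell s (x z : X) :=
  (Num.floor (height s x))%:~R <= height s z <= (Num.floor (height s x))%:~R + 1.

(** The union of the cells that meet [A1]; a face with a single vertex counts as one cell. *)
Definition coloring (x : X) : Prop := exists z s,
  [/\ A1 z, faces K s, simplex_of s x, simplex_of s z &
      #|` s| = 2%N -> same_cell s x z].

Lemma same_cell_dist s x z : same_cell s x z ->
  `|x (o s).1 - z (o s).1| <= (N s).+1%:R^-1.
Proof.
move=> /andP[h1 h2].
have h3 := floor_le (height s x); have h4 := floorD1_gt (height s x).
have N0 : 0 < (N s).+1%:R :> R by [].
rewrite -(ler_pM2l N0) divff ?gt_eqF// -[X in X * _]gtr0_norm// -normrM.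
rewrite ler_norml; rewrite intrD in h4.
rewrite /height in h1 h2 h3 h4.
rewrite mulrBr; apply/andP; split; lra.
Qed.

Lemma coloring_A1 x : A1 x -> coloring x.
Proof.
move=> Ax; have [s Ks sx] := barycentricP x; exists x, s; split=> // _.
rewrite /same_cell floor_le/=.
by have := floorD1_gt (height s x); rewrite intrD => /ltW.
Qed.

Lemma coloring_A2 x : A2 x -> ~ coloring x.
Proof.
move=> A2x [z [s [A1z Ks sx sz h]]].
have [s2|s2] := pselect (#|` s| = 2%N).
  have := N_apart Ks s2 sx sz A1z A2x.
  by rewrite ltNge (same_cell_dist (h s2)).
have [u su xu] := card1_vertex Ks s2 sx; have [u' su' zu] := card1_vertex Ks s2 sz.
have uu : u' = u by apply/esym/fset1P; rewrite -su' su inE.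
have : (A1 `&` A2) x by split=> //; rewrite (vertex_unique xu (y := z)) // -uu.
by rewrite A12.
Qed.

(** The star of [u] reaching half a cell into each edge. Its size varies with the edge, yet it is
    open in the weak topology even if infinitely many edges meet at [u]. *)
Definition near_vertex u : set X := [set x | 0 < x u /\
  forall s, faces K s -> #|` s| = 2%N -> simplex_of s x -> 1 - x u < (2 * (N s).+1%:R)^-1].

Lemma half_cell_gt0 s : 0 < (2 * (N s).+1%:R)^-1 :> R.
Proof. by rewrite invr_gt0 mulr_gt0. Qed.

Lemma near_vertex_open u : open (near_vertex u).
Proof.
apply: open_realization => s Ks.
have [us|us] := boolP (u \in s); last first.
  exists set0; first exact: open0.
  by move=> x [_ xs _]; split=> // -[]; rewrite xs// ltxx.
have [s2|s2] := pselect (#|` s| = 2%N); last first.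
  exists setT; first exact: openT.
  move=> x sx; split=> // _; have [u' su xu] := card1_vertex Ks s2 sx.
  have uu : u = u' by apply/fset1P; rewrite -su.
  rewrite /near_vertex /= uu xu; split=> // t _ _ _.
  by rewrite subrr half_cell_gt0.
exists [set f : {ptws V -> R} | 1 - (2 * (N s).+1%:R)^-1 < f u].
  have oB : open [set y : R | 1 - (2 * (N s).+1%:R)^-1 < y] by exact: open_gt.
  by apply: open_comp oB => f _; exact: (@proj_continuous V (fun=> R) u).
move=> x sx; split=> [[xu /(_ s Ks s2 sx)]|]; first by rewrite /= ltrBlDl ltrBlDr.
rewrite /= => xu.
have h2 : (2 * (N s).+1%:R)^-1 <= 2^-1 :> R.
  by rewrite lef_pV2 ?posrE ?mulr_gt0// ler_pMr// ler1n.
have xu0 : 0 < x u by move: xu h2; set h := (2 * _)^-1; lra.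
split=> [//|t Kt t2 tx].
have [st|st] := eqVneq t s; first by rewrite st; move: xu; rewrite ltrBlDl ltrBlDr.
have ut := support_mem tx xu0.
(* Two different edges through [u] have no other common point, so [x] is the vertex itself. *)
suff -> : x u = 1 by rewrite subrr half_cell_gt0.
have [_ _ x1] := sx; move: x1; rewrite (big_fsetD1 u us)/= big1_seq ?addr0// => v /=.
rewrite !inE => /andP[vu vs]; apply/eqP; rewrite eq_le (simplex_of_ge0 _ sx) andbT leNgt.
apply/negP => xv; have vt := support_mem tx xv.
by move/negP: st; apply; rewrite (edge_eq vu Kt vt ut) (edge_eq vu Ks vs us).
Qed.

(** If [A1] misses the vertex, it stays more than two cells away from it on each edge, while a
    witness [z] is within one cell of [x] and [x] within half a cell of the vertex. If [A1] contains
    the vertex, so does the closed cell of [x], for both values of [th]. *)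
Lemma coloring_near_vertex (x0 x : X) u : x0 u = 1 -> near_vertex u x ->
  coloring x <-> A1 x0.
Proof.
move=> x0u [xu xn]; split=> [[z [s [A1z Ks sx sz h]]]|A1x0].
  have us := support_mem sx xu.
  have [s2|s2] := pselect (#|` s| = 2%N); last first.
    have [v sv zv] := card1_vertex Ks s2 sz.
    have uv : u = v by apply/fset1P; rewrite -sv.
    by rewrite uv in x0u; rewrite (vertex_unique x0u zv).
  apply: contrapT => nA.
  have nA' (z' : X) : z' u = 1 -> ~ A1 z' by move=> z'u; rewrite (vertex_unique z'u x0u).
  have [sE vw] := oP Ks s2.
  have xE : x (o s).2 = 1 - x (o s).1.
    have [_ _ x1] := sx; move: x1; rewrite {1}sE big_fsetU1 ?inE//= big_seq_fset1 => <-.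
    by rewrite [x (o s).1 + _]addrC addrK.
  have hd := same_cell_dist (h s2).
  have hn := xn s Ks s2 sx.
  have N0 : 0 < (N s).+1%:R^-1 :> R by rewrite invr_gt0.
  rewrite invfM in hn.
  have [xv0 _ _] := sx.
  have x1 : x (o s).1 <= 1 by rewrite -subr_ge0 -xE.
  move: us; rewrite {1}sE !inE => /orP[/eqP uE|/eqP uE].
    have := N_vertex Ks s2 (u := u) (t := 1) _ nA' sz A1z.
    rewrite uE !eqxx /= => /(_ isT).
    have := ler_distD (x (o s).1) 1 (z (o s).1).
    rewrite (@ger0_norm _ (1 - x _)) ?subr_ge0//; rewrite uE in hn.
    by move: hd hn N0; set a := _^-1; lra.
  have := N_vertex Ks s2 (u := u) (t := 0) _ nA' sz A1z.
  rewrite uE !eqxx /= orbT => /(_ isT).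
  have := ler_distD (x (o s).1) 0 (z (o s).1).
  rewrite (distrC 0 (x _)) subr0 (@ger0_norm _ (x _))//; rewrite uE xE in hn.
  by move: hd hn N0; set a := _^-1; lra.
have [s Ks sx] := barycentricP x.
have us := support_mem sx xu.
exists x0, s; split=> //; first exact: vertex_simplex x0u us.
move=> s2; have [sE vw] := oP Ks s2.
have hn := xn s Ks s2 sx.
have [xv0 _ _] := sx.
have N0 : 0 < (N s).+1%:R :> R by [].
have xE : x (o s).2 = 1 - x (o s).1.
  have [_ _ x1] := sx; move: x1; rewrite {1}sE big_fsetU1 ?inE//= big_seq_fset1 => <-.
  by rewrite [x (o s).1 + _]addrC addrK.
have x0E : x0 (o s).2 = 1 - x0 (o s).1.
  have [_ _ x1] := vertex_simplex x0u us; move: x1; rewrite {1}sE big_fsetU1 ?inE//= big_seq_fset1 => <-.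
  by rewrite [x0 (o s).1 + _]addrC addrK.
have hn' : (N s).+1%:R * (1 - x u) < 1 / 2.
  by rewrite mulrC -ltr_pdivlMr// mul1r -invfM.
rewrite mulrBr mulr1 in hn'.
have fy := floor_le (height s x).
rewrite /same_cell; move: us; rewrite {1}sE !inE => /orP[/eqP uE|/eqP uE].
  have x1 : x u <= 1 by rewrite uE -subr_ge0 -xE.
  have y0E : height s x0 = (N s).+1%:R + th by rewrite /height -uE x0u mulr1.
  have yE : height s x = (N s).+1%:R * x u + th by rewrite /height -uE.
  have yy0 : height s x <= height s x0 by rewrite y0E yE lerD2r ler_piMr.
  rewrite (le_trans fy yy0)/=.
  case: thP => th0.
    have : (N s)%:Z <= Num.floor (height s x).
      rewrite floor_ge_int yE th0 addr0; move: hn'; rewrite -natr1; lra.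
    by rewrite -(ler_int R) y0E th0 addr0 -natr1 lerD2r.
  have : (N s).+1%:Z <= Num.floor (height s x).
    by rewrite floor_ge_int yE th0; move: hn'; rewrite -natr1; lra.
  by rewrite -(ler_int R) y0E th0 -[_%:~R]/(_%:R); lra.
have y0E : height s x0 = th by rewrite /height -(subKr 1 (x0 (o s).1)) -x0E -uE x0u subrr mulr0 add0r.
have yE : height s x = (N s).+1%:R * (1 - x u) + th by rewrite /height uE xE subKr.
have x1 : 0 <= (N s).+1%:R * (1 - x u) by rewrite mulr_ge0// uE xE subKr.
have th01 : 0 <= th <= 1 / 2 by case: thP => ->; lra.
have -> : Num.floor (height s x) = 0.
  apply: floor_def; rewrite yE; move: x1 hn'; rewrite mulrBr mulr1.
  by move: th01 => /andP[]; lra.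
by rewrite y0E; move: th01 => /andP[]; lra.
Qed.

(** Around an inner point of an edge no other edge is seen, and away from the nodes the floor of the
    height is locally constant. *)
Lemma coloring_near_interior (x0 : X) s : faces K s -> #|` s| = 2%N ->
  simplex_of s x0 -> 0 < x0 (o s).1 -> 0 < x0 (o s).2 ->
  (Num.floor (height s x0))%:~R < height s x0 ->
  \forall x \near x0, coloring x <-> coloring x0.
Proof.
move=> Ks s2 sx0 v0 w0 fl; have [sE vw] := oP Ks s2.
have only_s (x : X) t : 0 < x (o s).1 -> 0 < x (o s).2 -> faces K t ->
    simplex_of t x -> t = s.
  by move=> xv xw Kt tx; rewrite (edge_eq vw Kt (support_mem tx xv) (support_mem tx xw)) -sE.
have cg (x : X) : 0 < x (o s).1 -> 0 < x (o s).2 -> coloring x <->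
    exists z : X, [/\ A1 z, simplex_of s z & same_cell s x z].
  move=> xv xw; split=> [[z [t [A1z Kt tx tz h]]]|[z [A1z sz h]]].
    have ts := only_s _ _ xv xw Kt tx; rewrite ts in tz h.
    by exists z; split=> //; exact: h.
  have [t Kt tx] := barycentricP x; have ts := only_s _ _ xv xw Kt tx; rewrite ts in tx.
  by exists z, s; split.
have ch : {for x0, continuous (height s)}.
  exact: (cvgD (cvgM (cvg_cst _) (@barycentric_continuous R V K (o s).1 x0)) (cvg_cst _)).
have n1 : \forall x \near x0, 0 < (x : X) (o s).1.
  exact: (@barycentric_continuous R V K (o s).1 x0 _ (lt_nbhsr v0)).
have n2 : \forall x \near x0, 0 < (x : X) (o s).2.
  exact: (@barycentric_continuous R V K (o s).2 x0 _ (lt_nbhsr w0)).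
have n3 : \forall x \near x0, (Num.floor (height s x0))%:~R < height s x.
  exact: (ch _ (lt_nbhsr fl)).
have n4 : \forall x \near x0, height s x < (Num.floor (height s x0) + 1)%:~R.
  exact: (ch _ (lt_nbhsl (floorD1_gt (height s x0)))).
near=> x.
have xv : 0 < (x : X) (o s).1 by near: x.
have xw : 0 < (x : X) (o s).2 by near: x.
have h3 : (Num.floor (height s x0))%:~R < height s x by near: x.
have h4 : height s x < (Num.floor (height s x0) + 1)%:~R by near: x.
have fx : Num.floor (height s x) = Num.floor (height s x0).
  by apply: floor_def; rewrite h4 ltW.
by rewrite (cg _ xv xw) (cg _ v0 w0) /same_cell fx.
Unshelve. all: by end_near. Qed.

Lemma coloring_near (x0 : X) :
  (\forall x \near x0, coloring x <-> coloring x0) \/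
  exists s, [/\ faces K s, #|` s| = 2%N, 0 < x0 (o s).1, 0 < x0 (o s).2 & (Num.floor (height s x0))%:~R = height s x0].
Proof.
have [s Ks sx] := barycentricP x0.
have vert u : x0 u = 1 -> \forall x \near x0, coloring x <-> coloring x0.
  move=> x0u; have nx : near_vertex u x0.
    by split=> [|t _ _ _]; rewrite x0u ?subrr// half_cell_gt0.
  have := open_nbhs_nbhs (conj (near_vertex_open u) nx).
  by apply: filterS => x ux; rewrite (coloring_near_vertex x0u ux) (coloring_near_vertex x0u nx).
have [s2|s2] := pselect (#|` s| = 2%N); last first.
  by have [u _ /vert] := card1_vertex Ks s2 sx; left.
have [sE vw] := oP Ks s2; have [x0_ge0 _ x1] := sx.
rewrite sE big_fsetU1 ?inE//= big_seq_fset1 in x1.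
have [v0|v0] := ltP 0 (x0 (o s).1); last first.
  left; apply: (vert (o s).2); rewrite -x1.
  have -> : x0 (o s).1 = 0 by apply/eqP; rewrite eq_le v0 x0_ge0.
  by rewrite add0r.
have [w0|w0] := ltP 0 (x0 (o s).2); last first.
  left; apply: (vert (o s).1); rewrite -x1.
  have -> : x0 (o s).2 = 0 by apply/eqP; rewrite eq_le w0 x0_ge0.
  by rewrite addr0.
have := floor_le (height s x0); rewrite le_eqVlt => /orP[/eqP e|fl].
  by right; exists s.
by left; exact: coloring_near_interior sx v0 w0 fl.
Qed.

End grid_coloring.

(* The Eilenberg-Otto form of [dim <= 1]: two pairs of disjoint closed sets can
   be separated by partitions without a common point. The two grids on an edge
   are shifted by half a cell, hence have no common node. *)
Lemma one_dim_separation (R : realType) (V : choiceType)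
    (K : simplicial_complex V) (A1 A2 B1 B2 : set (realization R K)) :
  dim_le 1 K -> closed A1 -> closed A2 -> closed B1 -> closed B2 ->
  A1 `&` A2 = set0 -> B1 `&` B2 = set0 ->
  exists chi psi : realization R K -> Prop,
    [/\ (forall x, A1 x -> chi x), (forall x, A2 x -> ~ chi x),
        (forall x, B1 x -> psi x), (forall x, B2 x -> ~ psi x) &
        forall x, (\forall y \near x, chi y <-> chi x) \/
                  (\forall y \near x, psi y <-> psi x)].
Proof.
move=> dimK cA1 cA2 cB1 cB2 A12 B12.
have [[x00 _]|noX] := pselect (exists x : realization R K, True); last first.
  by exists (fun=> True), (fun=> True); split=> // x; case: noX; exists x.
have [v0 _] : exists v0 : V, True.
  have [s Ks _] := barycentricP x00.
  by have /fset0Pn[v _] := faces_neq0 Ks; exists v.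
have /choice[dir dirP] (s : {fset V}) : exists vw : V * V, faces K s -> #|` s| = 2%N ->
    s = [fset vw.1; vw.2]%fset /\ vw.1 != vw.2.
  have [[Ks s2]|ns] := pselect (faces K s /\ #|` s| = 2%N); last first.
    by exists (v0, v0) => Ks s2; case: ns.
  have [v vs] : exists v, v \in s by apply/fset0Pn; exact: faces_neq0 Ks.
  have [w ws] : exists w, w \in (s `\ v)%fset.
    apply/fset0Pn; rewrite -cardfs_gt0.
    by have := cardfsD1 v s; rewrite vs s2; case: #|` _|.
  move: ws; rewrite !inE => /andP[wv ws].
  have vw : v != w by rewrite eq_sym.
  by exists (v, w) => _ _; split=> //; exact: (edge_eq dimK vw Ks vs ws).
pose apart (A1 A2 : set (realization R K)) s v N :=
  forall x z : realization R K, simplex_of s x -> simplex_of s z ->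
    A1 z -> A2 x -> `|x v - z v| > N.+1%:R^-1.
pose off (A1 : set (realization R K)) s v w N :=
  forall u t, ((u == v) && (t == 1)) || ((u == w) && (t == 0)) ->
    (forall z : realization R K, z u = 1 -> ~ A1 z) ->
    forall z : realization R K, simplex_of s z -> A1 z -> `|t - z v| > 2 / N.+1%:R.
have /choice[N NP] (s : {fset V}) : exists N : nat, faces K s -> #|` s| = 2%N ->
    [/\ apart A1 A2 s (dir s).1 N, off A1 s (dir s).1 (dir s).2 N,
        apart B1 B2 s (dir s).1 N & off B1 s (dir s).1 (dir s).2 N].
  have [[Ks s2]|ns] := pselect (faces K s /\ #|` s| = 2%N); last first.
    by exists 0%N => Ks s2; case: ns.
  have [sE vw] := dirP s Ks s2; have Kvw := Ks; rewrite sE in Kvw.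
  have [NA hA] := fine_grid vw Kvw cA1 cA2 A12.
  have [NB hB] := fine_grid vw Kvw cB1 cB2 B12.
  rewrite -sE in hA hB.
  (* Both colorings use the same number of cells on an edge, so that the shift by half a cell makes
     their nodes disjoint. *)
  exists (maxn NA NB) => _ _.
  have [a1 a2] := hA _ (leq_maxl NA NB); have [b1 b2] := hB _ (leq_maxr NA NB).
  by split.
have NA s (Ks : faces K s) (s2 : #|` s| = 2%N) : apart A1 A2 s (dir s).1 (N s) by have [] := NP s Ks s2.
have NA' s (Ks : faces K s) (s2 : #|` s| = 2%N) : off A1 s (dir s).1 (dir s).2 (N s) by have [] := NP s Ks s2.
have NB s (Ks : faces K s) (s2 : #|` s| = 2%N) : apart B1 B2 s (dir s).1 (N s) by have [] := NP s Ks s2.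
have NB' s (Ks : faces K s) (s2 : #|` s| = 2%N) : off B1 s (dir s).1 (dir s).2 (N s) by have [] := NP s Ks s2.
exists (coloring dir A1 N 0), (coloring dir B1 N (1 / 2)); split.
- exact: coloring_A1.
- exact: coloring_A2.
- exact: coloring_A1.
- exact: coloring_A2.
move=> x.
have [nA|[s [Ks s2 sv sw fA]]] := coloring_near dimK dirP NA' (or_introl (erefl : 0 = 0 :> R)) x; first by left.
have [nB|[t [Kt t2 tv tw fB]]] := coloring_near dimK dirP NB' (or_intror (erefl : 1 / 2 = 1 / 2 :> R)) x; first by right.
exfalso.
have [sE svw] := dirP s Ks s2; have [tE tvw] := dirP t Kt t2.
have [s' Ks' s'x] := barycentricP x.
have es : s = s'.
  by rewrite (edge_eq dimK svw Ks' (support_mem s'x sv) (support_mem s'x sw)) -sE.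
have et : t = s'.
  by rewrite (edge_eq dimK tvw Ks' (support_mem s'x tv) (support_mem s'x tw)) -tE.
rewrite et -es in fB; move: fA fB; rewrite /height addr0 => <-.
set k := Num.floor _; set l := Num.floor _ => kl.
(* A common node would be an integer in both scales; doubling turns the shift by 1/2 into a parity
   contradiction. *)
have : (k + k)%:~R = (l + l + 1)%:~R :> R by rewrite !intrD kl; lra.
move=> /intr_inj; lia.
Qed.

(** * The slabs of the distance function *)

Section cut.
Variables (R : realType) (T : topologicalType) (d : T -> T -> \bar R).
Hypothesis d_ge0 : forall x y, (0 <= d x y)%E.
Hypothesis d_sym : forall x y, d x y = d y x.
Hypothesis d_triangle : forall x y z, (d x z <= d x y + d y z)%E.
Hypothesis d_near : forall (x : T) (e : R), 0 < e -> \forall y \near x, (d x y < e%:E)%E.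

Lemma d_fin x y (r : R) : (d x y <= r%:E)%E -> d x y \is a fin_num.
Proof. by move=> xy; rewrite ge0_fin_numE// (le_lt_trans xy (ltry r)). Qed.

Lemma ball_open (p : T) (r : R) : open [set q | (d p q < r%:E)%E].
Proof.
rewrite openE => q /= pq; rewrite /interior.
have fpq : d p q \is a fin_num by rewrite ge0_fin_numE// (lt_trans pq)// ltry.
have e0 : 0 < r - fine (d p q) by rewrite subr_gt0 -lte_fin fineK.
apply: filterS (d_near q e0) => s qs /=.
apply: (le_lt_trans (d_triangle p q s)).
by rewrite -lteBrDl// -(fineK fpq).
Qed.

Lemma coball_open (p : T) (r : R) : open [set q | (r%:E < d p q)%E].
Proof.
rewrite openE => q /= pq; rewrite /interior.
have [qy|qy] := eqVneq (d p q) +oo%E.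
  apply: filterS (d_near q ltr01) => s qs /=.
  rewrite ltNge; apply/negP => psr; have := d_triangle p s q; rewrite qy leNgt.
  have sq : (d s q < +oo)%E by rewrite d_sym (lt_trans qs (ltry 1)).
  by rewrite lte_add_pinfty ?(le_lt_trans psr (ltry r)).
have fpq : d p q \is a fin_num by rewrite ge0_fin_numE// lt_neqAle qy leey.
have e0 : 0 < fine (d p q) - r by rewrite subr_gt0 -lte_fin fineK.
apply: filterS (d_near q e0) => s qs /=.
have := d_triangle p s q; rewrite (d_sym s q) => h.
rewrite ltNge; apply/negP => psr.
have : (d p q < r%:E + (fine (d p q) - r)%:E)%E.
  by apply: (le_lt_trans h); apply: lee_ltD => //; exact: d_fin psr.
by rewrite -EFinD addrC subrK fineK// ltxx.
Qed.

Lemma closed_ball_closed (p : T) (r : R) : closed [set q | (d p q <= r%:E)%E].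
Proof.
rewrite (_ : [set q | _] = ~` [set q | (r%:E < d p q)%E]).
  exact/open_closedC/coball_open.
by apply/seteqP; split=> q /= => [h|/negP]; [apply/negP|]; rewrite -leNgt.
Qed.

Lemma cocball_closed (p : T) (r : R) : closed [set q | (r%:E <= d p q)%E].
Proof.
rewrite (_ : [set q | _] = ~` [set q | (d p q < r%:E)%E]).
  exact/open_closedC/ball_open.
by apply/seteqP; split=> q /= => [h|/negP]; [apply/negP|]; rewrite -leNgt.
Qed.

Hypothesis T_compact : compact [set: T].

(* The cut is the part, below the level [r] of [d p], of a small sphere around
   [x]. Any path into the ball of radius [1/5] around [x] that crosses the shell
   between the radii [1/5] and [4/15] deep below that level has period 1. *)
Lemma local_cut (F : comNzRingType) (p x : T) (r : R) :
  (UW d 1 [set q | (d x q <= 1)%E] < (1 / 15)%:E)%E ->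
  exists (j : T -> T -> F^o) (g : T -> F^o),
  [/\ local_cocycle j,
    (forall a, (d x a <= (1 / 5)%:E)%E -> g a = 1),
    (forall a, ((4 / 15)%:E <= d x a)%E -> g a = 0),
    (forall a b, ((r - 1 / 30)%:E < d p a)%E -> ((r - 1 / 30)%:E < d p b)%E -> j a b = 0) &
    [/\ (forall a b, (d x a < (1 / 5)%:E)%E -> (d x b < (1 / 5)%:E)%E -> j a b = g b - g a),
      (forall a b, ((4 / 15)%:E < d x a)%E -> ((4 / 15)%:E < d x b)%E -> j a b = 0) &
      (forall a b, (d x a < 1)%E -> (d x b < 1)%E ->
        (d p a < (r - 1 / 10)%:E)%E -> (d p b < (r - 1 / 10)%:E)%E -> j a b = g b - g a)]].
Proof.
set B := [set q | _].
move=> /ereal_inf_lt[w [V [K [f [dimK cf ->]]]] wlt].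
have fibre a b : B a -> B b -> f a = f b -> (d a b < (1 / 15)%:E)%E.
  move=> Ba Bb fab; apply: le_lt_trans wlt.
  apply: (@le_trans _ _ (diam d (B `&` f @^-1` [set f b]))).
    by apply: ereal_sup_ubound; exists a, b.
  by apply: ereal_sup_ubound; exists (f b).
have cB : compact B.
  by apply: (subclosed_compact _ T_compact) => //; exact: closed_ball_closed.
have cimage (A : set T) : closed A -> closed (f @` (B `&` A)).
  move=> cA; apply: compact_closed; first exact: realization_hausdorff.
  apply: continuous_compact; last exact: compact_closedI.
  by apply: continuous_subspaceW cf; exact: subIsetl.
(* The gap between [u] and [v] is larger than the distance between any two points of a fibre. *)
have disj (q : T) (u v : R) : u + 1 / 15 = v ->
    (f @` (B `&` [set a | (d q a <= u%:E)%E])) `&`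
    (f @` (B `&` [set a | (v%:E <= d q a)%E])) = set0.
  move=> uv; apply/seteqP; split=> // y [[a [Ba /= qa] fa] [b [Bb /= qb] fb]].
  have ab := fibre a b Ba Bb (etrans fa (esym fb)).
  have : (d q b < v%:E)%E.
    apply: (le_lt_trans (d_triangle q a b)).
    by rewrite -uv EFinD; apply: lee_ltD => //; exact: d_fin qa.
  by rewrite ltNge qb.
have [|||||||chi [psi [chi1 chi2 psi1 psi2 loc]]] := @one_dim_separation R V K
    (f @` (B `&` [set a | (d x a <= (1 / 5)%:E)%E]))
    (f @` (B `&` [set a | ((4 / 15)%:E <= d x a)%E]))
    (f @` (B `&` [set a | (d p a <= (r - 1 / 10)%:E)%E]))
    (f @` (B `&` [set a | ((r - 1 / 30)%:E <= d p a)%E])).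
- exact: dimK.
- by apply: cimage; exact: closed_ball_closed.
- by apply: cimage; exact: cocball_closed.
- by apply: cimage; exact: closed_ball_closed.
- by apply: cimage; exact: cocball_closed.
- by apply: disj; lra.
- by apply: disj; lra.
pose g a : F^o := if `[< B a /\ chi (f a) >] then 1 else 0.
(* [psi] switches the count on below the level, and is tested at the first point only. This is
   harmless: where [psi] is locally constant, [j] is the coboundary of [g] or 0, and where [chi] is
   locally constant, [g] does not vary and [j] is 0. *)
pose j a b : F^o := if `[< [/\ B a, B b & psi (f a)] >] then g b - g a else 0.
have g1 a : (d x a <= (1 / 5)%:E)%E -> g a = 1.
  move=> xa; rewrite /g; case: asboolP => // -[].
  have Ba : B a by apply: (le_trans xa); rewrite lee_fin; lra.
  by split=> //; apply: chi1; exists a.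
have g0 a : ((4 / 15)%:E <= d x a)%E -> g a = 0.
  move=> xa; rewrite /g; case: asboolP => // -[Ba].
  by move=> /chi2 []; exists a.
have j_eq a b : g a = g b -> j a b = 0.
  by move=> gab; rewrite /j gab subrr; case: ifP.
exists j, g; split=> //.
- move=> m; have [xm|xm] := ltP ((4 / 15)%:E) (d x m).
    exists [set a | ((4 / 15)%:E < d x a)%E].
      exact: open_nbhs_nbhs (conj (coball_open x _) xm).
    move=> a b c /= xa xb xc.
    by rewrite !j_eq ?addr0// !g0// ltW.
  have Bm : B m by apply: (le_trans xm); rewrite lee_fin; lra.
  (* [f] is continuous only relatively to [B], but [B] is a neighbourhood of [m] as 4/15 < 1. *)
  have near_f (P : set (realization R K)) : nbhs (f m) P -> \forall a \near m, B a /\ P (f a).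
    move=> Pm; apply: filterI.
      have oB := ball_open x 1; apply: filterS (open_nbhs_nbhs (conj oB _)) => [a|].
        exact: ltW.
      by rewrite /=; apply: (le_lt_trans xm); rewrite lte_fin; lra.
    have nB : nbhs m B.
      have oB := ball_open x 1; apply: filterS (open_nbhs_nbhs (conj oB _)) => [a|].
        exact: ltW.
      by rewrite /=; apply: (le_lt_trans xm); rewrite lte_fin; lra.
    have := (subspace_continuousP _ _).1 cf m Bm P Pm; rewrite /within/= => H.
    have H' : \forall a \near m, B a -> P (f a) by exact: H.
    by apply: filterS2 nB H' => a Ba; apply.
  have [/near_f n|/near_f n] := loc (f m).
    exists [set a | B a /\ (chi (f a) <-> chi (f m))]; first exact: n.
    have gE a : B a /\ (chi (f a) <-> chi (f m)) -> g a = g m.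
      move=> [Ba e]; rewrite /g; congr (if _ then _ else _).
      by apply: asbool_equiv_eq; rewrite e; split=> -[].
    by move=> a b c /gE ga /gE gb /gE gc; rewrite !j_eq ?addr0// ?ga ?gb ?gc.
  exists [set a | B a /\ (psi (f a) <-> psi (f m))]; first exact: n.
  have jE a b : B a /\ (psi (f a) <-> psi (f m)) -> B b ->
      j a b = if `[< psi (f m) >] then g b - g a else 0.
    move=> [Ba e] Bb; rewrite /j; congr (if _ then _ else _).
    by apply: asbool_equiv_eq; rewrite -e; split=> [[]|].
  move=> a b c ha hb hc; rewrite (jE a b ha hb.1) (jE b c hb hc.1) (jE a c ha hc.1).
  case: ifP => _; last by rewrite addr0.
  by rewrite addrC subrKA.
- move=> a b pa pb; rewrite /j; case: asboolP => // -[Ba Bb].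
  by move=> /psi2 []; exists a => //; split=> //; exact: ltW.
split=> [a b xa xb|a b xa xb|a b xa xb pa pb].
- by rewrite j_eq !g1 ?subrr// ltW.
- by rewrite j_eq// !g0// ltW.
- rewrite /j; case: asboolP => // -[]; split; [exact: ltW|exact: ltW|].
  by apply: psi1; exists a => //; split; exact: ltW.
Qed.

End cut.

(** * Paths in a thin slab and their dual loops *)

Section slab.
Variables (R : realType) (T : topologicalType) (d : T -> T -> \bar R).
Hypothesis d_ge0 : forall x y, (0 <= d x y)%E.
Hypothesis d_sym : forall x y, d x y = d y x.
Hypothesis d_triangle : forall x y z, (d x z <= d x y + d y z)%E.
Hypothesis d_near : forall (x : T) (e : R), 0 < e -> \forall y \near x, (d x y < e%:E)%E.
Hypothesis d_path : forall x y (r : \bar R), (d x y < r)%E ->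
  exists g : R -> T, [/\ continuous g, g 0 = x, g 1 = y &
    forall t, (d x (g t) + d (g t) y < r)%E].
Hypothesis T_compact : compact [set: T].
Hypothesis balls : forall x, (UW d 1 [set y | (d x y <= 1)%E] < (1 / 15)%:E)%E.
Variables (F : fieldType) (b : nat).
Hypothesis rank_b : homology_rank (R := R) F T 1 b.

Lemma dist_continuous (x : T) (g : R -> T) : continuous g ->
  (forall t, d x (g t) \is a fin_num) -> continuous (fun t => fine (d x (g t))).
Proof.
move=> cg fg t; apply/cvgrPdist_lt => e e0.
have : \forall s \near t, (d (g t) (g s) < e%:E)%E by exact: (cg t _ (d_near (g t) e0)).
apply: filterS => s ts.
have fts : d (g t) (g s) \is a fin_num by exact: (d_fin d_ge0 (ltW ts)).
have h1 := d_triangle x (g t) (g s); have h2 := d_triangle x (g s) (g t).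
rewrite (d_sym (g s)) in h2.
rewrite -(fineK (fg t)) -(fineK (fg s)) -(fineK fts) -?EFinD !lee_fin lte_fin in h1 h2 ts.
by rewrite ltr_norml; lra.
Qed.

Section fan.
Variables (p : T) (r : R) (gamma : R -> T).
Hypothesis gamma_cont : continuous gamma.
Hypothesis gamma_slab : forall t,
  ((r - 1 / 100)%:E < d p (gamma t))%E /\ (d p (gamma t) < (r + 1 / 100)%:E)%E.

Lemma spoke_exists t : exists g : R -> T, [/\ continuous g, g 0 = p, g 1 = gamma t &
  forall s, (d p (g s) + d (g s) (gamma t) < (r + 1 / 50)%:E)%E].
Proof.
have [_ h] := gamma_slab t.
have := @d_path p (gamma t) (r + 1 / 50)%:E _; apply.
by apply: (lt_trans h); rewrite lte_fin; lra.
Qed.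

(** If [q] were within 4/15 of [x], a path through [q] would cost more than r - 1/100 - 4/15 before
    [q] and at least 9/10 - 4/15 after it, in total more than r + 1/50. *)
Lemma spoke_far (x z q : T) : (d p q + d q z < (r + 1 / 50)%:E)%E ->
  ((r - 1 / 100)%:E < d p x)%E -> ((9 / 10)%:E <= d x z)%E -> ((4 / 15)%:E < d x q)%E.
Proof.
move=> pqz px xz.
have [xq|xq] := ltP ((4 / 15)%:E) (d x q); first by [].
have fxq := d_fin d_ge0 xq.
have fpq : d p q \is a fin_num.
  apply: (d_fin d_ge0 (r := r + 1 / 50)); apply: le_trans (ltW pqz).
  by rewrite leeDl.
have fqz : d q z \is a fin_num.
  apply: (d_fin d_ge0 (r := r + 1 / 50)); apply: le_trans (ltW pqz).
  by rewrite leeDr.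
have h1 := lt_le_trans px (d_triangle p q x); rewrite (d_sym q) in h1.
have h2 := le_trans xz (d_triangle x q z).
rewrite -(fineK fpq) -(fineK fqz) -(fineK fxq) -?EFinD ?lee_fin ?lte_fin in h1 h2 pqz xq.
by exfalso; clear px xz; lra.
Qed.

(** At least 1/5 of the total r + 1/50 is still to be spent after [q], and 1/50 - 1/5 < -1/10. *)
Lemma spoke_near (x q : T) : (d p q + d q x < (r + 1 / 50)%:E)%E ->
  ((1 / 5)%:E <= d x q)%E -> (d p q < (r - 1 / 10)%:E)%E.
Proof.
move=> pqx xq; rewrite (d_sym x) in xq.
have fpq : d p q \is a fin_num.
  apply: (d_fin d_ge0 (r := r + 1 / 50)); apply: le_trans (ltW pqx).
  by rewrite leeDl.
have fqx : d q x \is a fin_num.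
  apply: (d_fin d_ge0 (r := r + 1 / 50)); apply: le_trans (ltW pqx).
  by rewrite leeDr.
rewrite -(fineK fpq) -(fineK fqx) -?EFinD ?lee_fin ?lte_fin in pqx xq *.
by lra.
Qed.

(* Otherwise the points at distance [9/10 * k] from [gamma 0] on [gamma] span,
   with their spokes to [p], [b + 1] loops dual to the cuts at their ends. *)
Lemma slab_diam : (d (gamma 0%R) (gamma 1%R) < ((b%:R + 1) * (9 / 10))%:E)%E.
Proof.
rewrite ltNge; apply/negP => far.
have fin_p t : d p (gamma t) \is a fin_num.
  by have [_ /ltW/(d_fin d_ge0)] := gamma_slab t.
have fin_g s t : d (gamma s) (gamma t) \is a fin_num.
  rewrite ge0_fin_numE//; apply: (le_lt_trans (d_triangle _ p _)).
  by rewrite (d_sym _ p) lte_add_pinfty// -ge0_fin_numE// fin_p.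
(* The neighbourhood in [d_near] contains the point itself, so its distance to itself is below every
   positive [e]. *)
have d00 : fine (d (gamma 0) (gamma 0)) = 0.
  apply/eqP; rewrite eq_le fine_ge0// andbT; apply/ler_addgt0Pr => e e0; rewrite add0r.
  have := nbhs_singleton (d_near (gamma 0) e0).
  by rewrite -{1}(fineK (fin_g 0 0)) lte_fin => /ltW.
(* The multiples start at 9/10 rather than 0: the points must also be far from [gamma 0], the end of
   the spoke shared by all the loops. *)
have /choice[t ht] (i : 'I_b.+1) : exists t : R, 0 <= t <= 1 /\
    fine (d (gamma 0) (gamma t)) = i.+1%:R * (9 / 10).
  have [| | |c] := @IVT R (fun t => fine (d (gamma 0) (gamma t))) 0 1 (i.+1%:R * (9 / 10)).
  - exact: ler01.
  - by apply: continuous_subspaceT; exact: dist_continuous.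
  - rewrite d00 (min_idPl _) ?fine_ge0// (max_idPr _) ?fine_ge0//.
    have c9 : 0 <= 9 / 10 :> R by lra.
    rewrite mulr_ge0//=.
    move: far; rewrite -{1}(fineK (fin_g 0 1)) lee_fin; apply: le_trans.
    by rewrite ler_wpM2r// natr1 ler_nat.
  - by rewrite in_itv/= => c01 ec; exists c.
pose z i := gamma (t i).
have z0 i : ((9 / 10)%:E <= d (z i) (gamma 0))%E.
  rewrite d_sym -(fineK (fin_g _ _)) lee_fin (ht i).2 -{1}[9 / 10]mul1r ler_wpM2r ?ler1n//; lra.
have zz i k : i != k -> ((9 / 10)%:E <= d (z i) (z k))%E.
  move=> ik; wlog lik : i k ik / (i < k)%N.
    move=> H; have := ik; rewrite -val_eqE neq_ltn => /orP[|] l; first exact: H.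
    by rewrite d_sym; apply: H; rewrite // eq_sym.
  have := d_triangle (gamma 0) (z i) (z k).
  rewrite -(fineK (fin_g 0 (t k))) -(fineK (fin_g 0 (t i))) -(fineK (fin_g (t i) (t k))).
  rewrite -EFinD !lee_fin (ht i).2 (ht k).2 => h.
  have ik1 : (i.+1%:R + 1) * (9 / 10) <= k.+1%:R * (9 / 10) :> R.
    by rewrite ler_wpM2r// ?natr1 ?ler_nat//; lra.
  move: h ik1; set u := i.+1%:R; set v := k.+1%:R; lra.
(* Two points of the slab are 9/10 apart and both within r + 1/100 of [p]. Consequently [p] lies
   outside the ball of radius 4/15 around every [z k], where [g] vanishes. *)
have r_large : 2 / 5 < r.
  have := le_trans (z0 ord0) (d_triangle _ p _); rewrite (d_sym _ p).
  have [_ h1] := gamma_slab (t ord0); have [_ h2] := gamma_slab 0.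
  rewrite -(fineK (fin_p (t ord0))) -(fineK (fin_p 0)) -?EFinD ?lee_fin ?lte_fin in h1 h2 *.
  lra.
clear far; have n1 : 4 / 15 <= r - 1 / 100 by lra.
have n2 : r - 1 / 30 <= r - 1 / 100 by lra.
have n3 : 4 / 15 < 1 :> R by lra.
have n4 : 0 < 1 / 5 :> R by lra.
have [c0 [c0_cont c00 c01 c0P]] := spoke_exists 0.
have /choice[c cP] (i : 'I_b.+1) := spoke_exists (t i).
have c_cont i : continuous (c i) by have [] := cP i.
pose a i (s : R) := gamma (affine 0 (t i) s).
have a_cont i : continuous (a i).
  by move=> s; apply: continuous_comp; [exact: affine_continuous|exact: gamma_cont].
pose L i : chain F R T 1 := << path_simplex (c_cont i) >> - << path_simplex (a_cont i) >>
   - << path_simplex c0_cont >>.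
have boundaryB (u v : chain F R T 1) : boundary (u - v) = boundary u - boundary v.
  by rewrite /boundary raddfB.
have cycL i : is_cycle (L i).
  have [_ ci0 ci1 _] := cP i.
  rewrite /= /L !boundaryB !boundary_path ci0 ci1 c00 c01 /a /affine mulr0 mulr1 !add0r.
  have tele (V : zmodType) (x y w : V) : x - y - (x - w) - (w - y) = 0.
    by rewrite !opprB (addrC (x - y)) !subrKA subrr.
  exact: tele.
have /choice[jg cut] (k : 'I_b.+1) : exists jg : (T -> T -> F^o) * (T -> F^o),
  [/\ local_cocycle jg.1,
    (forall a, (d (z k) a <= (1 / 5)%:E)%E -> jg.2 a = 1),
    (forall a, ((4 / 15)%:E <= d (z k) a)%E -> jg.2 a = 0),
    (forall a b, ((r - 1 / 30)%:E < d p a)%E -> ((r - 1 / 30)%:E < d p b)%E -> jg.1 a b = 0) &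
    [/\ (forall a b, (d (z k) a < (1 / 5)%:E)%E -> (d (z k) b < (1 / 5)%:E)%E -> jg.1 a b = jg.2 b - jg.2 a),
      (forall a b, ((4 / 15)%:E < d (z k) a)%E -> ((4 / 15)%:E < d (z k) b)%E -> jg.1 a b = 0) &
      (forall a b, (d (z k) a < 1)%E -> (d (z k) b < 1)%E ->
        (d p a < (r - 1 / 10)%:E)%E -> (d p b < (r - 1 / 10)%:E)%E -> jg.1 a b = jg.2 b - jg.2 a)]].
  have [j [g h]] := @local_cut R T d d_ge0 d_sym d_triangle d_near T_compact F p (z k) r (balls _).
  by exists (j, g).
suff : (b.+1 <= b)%N by rewrite ltnn.
apply: (homology_rank_dual (j := fun k => (jg k).1) rank_b cycL) => [k|i k].
  by have [] := cut k.
have [lc g1 g0 jslab [jin jout jdeep]] := cut k.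
have far_zero (g : R -> T) (cg : continuous g) : (forall s, ((4 / 15)%:E < d (z k) (g s))%E) ->
    transport (jg k).1 (path_simplex cg) = 0.
  move=> gfar; rewrite (transport_path lc cg (f := fun=> 0)) ?subrr// => s _.
  exists setT; first exact: filterT.
  by move=> u v _ _ _ _; rewrite jout ?subrr.
have zk_slab : ((r - 1 / 100)%:E < d p (z k))%E by have [] := gamma_slab (t k).
rewrite /L /period !raddfB/= !liftU !scale1r.
have -> : transport (jg k).1 (path_simplex c0_cont) = 0.
  by apply: far_zero => s; exact: spoke_far (c0P s) zk_slab (z0 k).
have -> : transport (jg k).1 (path_simplex (a_cont i)) = 0.
  rewrite (transport_path lc (a_cont i) (f := fun=> 0)) ?subrr// => s _.
  exists setT; first exact: filterT.
  have slab u : ((r - 1 / 30)%:E < d p (a i u))%E.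
    have [h _] := gamma_slab (affine 0 (t i) u); apply: le_lt_trans h.
    by rewrite lee_fin.
  by move=> u v _ _ _ _; rewrite jslab ?subrr.
rewrite !subr0; have [_ ci0 ci1 ciP] := cP i.
have [ik|ik] := eqVneq i k; last first.
  by apply: far_zero => s; apply: spoke_far (ciP s) zk_slab _; apply: zz; rewrite eq_sym.
rewrite {i}ik in ci0 ci1 ciP *.
(* [g] is a primitive of the cocycle along the spoke to [z k], equal to 0 at [p] and to 1 at [z k].
   Beyond 4/15 and within 1/5 this is direct; in the shell between, the spoke is deep enough by
   [spoke_near]. *)
rewrite (transport_path lc (c_cont k) (f := (jg k).2 \o c k)).
  rewrite /= ci0 ci1 g1 ?g0 ?subr0//.
    by rewrite d_sym; apply: le_trans (ltW zk_slab); rewrite lee_fin.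
  by apply/ltW; exact: (nbhs_singleton (d_near _ n4)).
move=> s _; have pull (U : set T) : open U -> U (c k s) -> nbhs s (c k @^-1` U).
  by move=> oU Us; apply: (c_cont k s); exact: open_nbhs_nbhs.
have [far_s|near_s] := ltP ((4 / 15)%:E) (d (z k) (c k s)).
  exists (c k @^-1` [set q | ((4 / 15)%:E < d (z k) q)%E]).
    by apply: pull => //; exact: coball_open.
  by move=> u v /= hu hv _ _; rewrite jout// !g0 ?subrr// ltW.
have [in_s|out_s] := ltP (d (z k) (c k s)) ((1 / 5)%:E).
  exists (c k @^-1` [set q | (d (z k) q < (1 / 5)%:E)%E]).
    by apply: pull => //; exact: ball_open.
  by move=> u v /= hu hv _ _; rewrite jin.
have deep := spoke_near (ciP s) out_s.
exists (c k @^-1` ([set q | (d (z k) q < 1%:E)%E] `&` [set q | (d p q < (r - 1 / 10)%:E)%E])).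
  apply: pull; first by apply: openI; exact: ball_open.
  by split=> //=; apply: (le_lt_trans near_s); rewrite lte_fin.
by move=> u v /= [hu1 hu2] [hv1 hv2] _ _; rewrite jdeep.
Qed.
End fan.
End slab.

(** * The Reeb graph *)

Lemma continuous_glue (R : realType) (T : topologicalType) (f g : R -> T) (a : R) :
  continuous f -> continuous g -> f a = g a ->
  continuous (fun t => if t <= a then f t else g t).
Proof.
move=> cf cg fga; set h := fun t => _.
apply/continuous_subspace_setT.
have -> : [set: R] = [set t | t <= a] `|` [set t | a <= t].
  by apply/seteqP; split=> // t _ /=; have [|/ltW] := leP t a; [left|right].
apply: withinU_continuous; [exact: closed_le|exact: closed_ge| |].
  apply: (@subspace_eq_continuous _ _ _ f); last exact: continuous_subspaceT.
  by move=> t; rewrite inE /= => ta; rewrite /from_subspace /h ta.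
apply: (@subspace_eq_continuous _ _ _ g); last exact: continuous_subspaceT.
move=> t; rewrite inE /= => ta; rewrite /from_subspace /h; case: ifP => // ta'.
by have -> : t = a by apply/eqP; rewrite eq_le ta ta'.
Qed.

Section joined.
Variables (R : realType) (T : topologicalType).

Definition joined (S : set T) (x y : T) : Prop := exists g : R -> T,
  [/\ continuous g, g 0 = x, g 1 = y & forall t, S (g t)].

Lemma joined_refl (S : set T) x : S x -> joined S x x.
Proof. by move=> Sx; exists (fun=> x); split=> //; exact: cst_continuous. Qed.

Lemma joined_sym (S : set T) x y : joined S x y -> joined S y x.
Proof.
move=> [g [cg g0 g1 gS]]; exists (g \o affine 1 (-1)); split.
- by move=> t; apply: continuous_comp; [exact: affine_continuous|exact: cg].
- by rewrite /= /affine mulr0 addr0.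
- by rewrite /= /affine mulr1 subrr.
- by move=> t; exact: gS.
Qed.

Lemma joined_trans (S : set T) x y z : joined S x y -> joined S y z -> joined S x z.
Proof.
move=> [f [cf f0 f1 fS]] [g [cg g0 g1 gS]].
exists (fun t => if t <= 1 / 2 then (f \o affine 0 2) t else (g \o affine (-1) 2) t); split.
- apply: continuous_glue => [t|t|].
  + by apply: continuous_comp; [exact: affine_continuous|exact: cf].
  + by apply: continuous_comp; [exact: affine_continuous|exact: cg].
  + rewrite /= /affine add0r mulrC divfK// f1.
    by rewrite addNr g0.
- by rewrite divr_ge0// /= /affine mulr0 addr0.
- rewrite ifF; last by apply/negbTE; rewrite -ltNge; lra.
  by rewrite /= /affine mulr1 (_ : -1 + 2 = 1) ?g1//; lra.
- by move=> t; case: ifP => _; [exact: fS|exact: gS].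
Qed.

End joined.

(** Any two vertices span an edge, so that the edges reached by the map do not have to be
    described. *)
Definition complete_graph (V : choiceType) : simplicial_complex V.
Proof.
apply: (@SimplicialComplex V [set s | s != fset0 /\ (#|` s| <= 2)%N]).
- by move=> s [].
- move=> s t [s0 s2] ts t0; split=> //.
  exact: leq_trans (fsubset_leq_card ts) s2.
Defined.

(** Continuity of the coordinates does not control the weak topology in general; it does when all
    the nearby values lie in one closed simplex. *)
Lemma continuous_to_realization (R : realType) (V : choiceType)
    (K : simplicial_complex V) (T : topologicalType) (f : T -> realization R K) (x : T) s :
  faces K s -> (\forall y \near x, simplex_of s (f y)) ->
  (forall v, {for x, continuous (fun y => f y v)}) -> {for x, continuous f}.
Proof.
move=> Ks fs cf U; rewrite nbhsE => -[W [oW Wfx] WU].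
have [B oB hB] := realization_openP oW Ks.
have cF : (fun y => f y : V -> R) @ x --> (f x : {ptws V -> R}) by exact: cvg_ptws.
have Ofx : B (f x : V -> R) by have [h _] := hB _ (nbhs_singleton fs); exact: h.
have n1 : \forall y \near x, B (f y : V -> R).
  exact: (cF _ (open_nbhs_nbhs (conj oB Ofx))).
suff : \forall y \near x, U (f y) by [].
by apply: filterS2 fs n1 => y sy Oy; apply: WU; have [_ h] := hB _ sy; exact: h.
Qed.

Section plateau.
Variable R : realType.

(* The support is smaller than [-1, 1], so that all the points close to a given one
   have their nonzero coordinates on one edge of the Reeb graph. *)
Definition plateau (y : R) : R := Num.min 1 (Num.max 0 (2 - 3 * `|y|)).

Lemma plateau_ge0 y : 0 <= plateau y.
Proof. by rewrite /plateau le_min ler01 le_max lexx. Qed.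

Lemma plateau_eq0 y : 2 / 3 <= `|y| -> plateau y = 0.
Proof.
move=> hy; rewrite /plateau (max_idPl _); last by lra.
by rewrite (min_idPr _).
Qed.

Lemma plateau_gt0 y : 0 < plateau y -> `|y| < 2 / 3.
Proof. by move=> h; rewrite ltNge; apply: contraTN h => /plateau_eq0 ->; rewrite ltxx. Qed.

Lemma plateauD y : 0 <= y <= 1 -> plateau y + plateau (y - 1) = 1.
Proof.
move=> /andP[y0 y1]; rewrite /plateau (ger0_norm y0) ler0_norm ?subr_le0//.
rewrite !minEle !maxEle; do ?case: ifP; move=> *; lra.
Qed.

Lemma plateau_continuous : continuous plateau.
Proof.
move=> y; apply: (@continuous_min R R (cst 1) (fun y => Num.max 0 (2 - 3 * `|y|))).
  exact: cst_continuous.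
apply: (@continuous_max R R (cst 0) (fun y => 2 - 3 * `|y|)); first exact: cst_continuous.
apply: (cvgB (cvg_cst _) (cvgM (cvg_cst _) _)).
exact: norm_continuous.
Qed.
End plateau.

Lemma simplex_of_change (R : realType) (V : choiceType) (s t : {fset V}) (x : V -> R) :
  simplex_of s x -> (forall v, v \notin t -> x v = 0) -> simplex_of t x.
Proof.
move=> [x0 xs x1] xt; split=> //; rewrite -x1.
transitivity (\sum_(v <- (t `|` s)%fset) x v); last apply/esym.
  by apply: big_fset_incl (fsubsetUl t s) _ => v _ /xt.
by apply: big_fset_incl (fsubsetUr t s) _ => v _ /xs.
Qed.

Section reeb.
Variables (R : realType) (T : topologicalType) (d : T -> T -> \bar R).
Hypothesis d_ge0 : forall x y, (0 <= d x y)%E.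
Hypothesis d_sym : forall x y, d x y = d y x.
Hypothesis d_triangle : forall x y z, (d x z <= d x y + d y z)%E.
Hypothesis d_near : forall (x : T) (e : R), 0 < e -> \forall y \near x, (d x y < e%:E)%E.
Hypothesis locally_joined : forall (x : T) U, nbhs x U -> \forall y \near x, joined R U x y.
Variable D : R.
Hypothesis slab_bound : forall (p : T) (r : R) (g : R -> T), continuous g ->
  (forall t, ((r - 1 / 100)%:E < d p (g t))%E /\ (d p (g t) < (r + 1 / 100)%:E)%E) ->
  (d (g 0%R) (g 1%R) < D%:E)%E.

Let finite_class q := [set x | (d x q < +oo)%E].

(* [d] is infinite between points of distinct connected components, hence one base
   point for each class of points at finite distance. *)
Definition base q : T := xget q (finite_class q).

Let d_self q : (d q q < +oo)%E.
Proof. exact: lt_trans (nbhs_singleton (d_near q ltr01)) (ltry 1). Qed.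

Lemma base_fin q : d (base q) q \is a fin_num.
Proof.
rewrite ge0_fin_numE// /base; case: xgetP => [x -> //|/(_ q)].
by case; exact: d_self.
Qed.

Lemma base_eq q q' : (d q q' < +oo)%E -> base q = base q'.
Proof.
move=> qq'; have e : finite_class q = finite_class q'.
  apply/seteqP; split=> x /= h.
    by apply: (le_lt_trans (d_triangle x q q')); rewrite lte_add_pinfty.
  by apply: (le_lt_trans (d_triangle x q' q)); rewrite (d_sym q') lte_add_pinfty.
rewrite /base e /xget; case: pselect => // -[]; exists q'.
by apply/asboolP; exact: d_self.
Qed.

Lemma near_base q : \forall q' \near q, base q' = base q.
Proof.
by apply: filterS (d_near q ltr01) => q' h; apply/esym/base_eq/(lt_trans h)/ltry.
Qed.

(** The factor 100 puts the centers of the slabs at the integers and makes their half-width 1. *)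
Definition level q : R := fine (d (base q) q) * 100.

Lemma level_ge0 q : 0 <= level q.
Proof. by rewrite mulr_ge0// fine_ge0. Qed.

Lemma level_continuous : continuous level.
Proof.
move=> q; apply/cvgrPdist_lt => e e0; have e1 : 0 < e / 100 by rewrite divr_gt0.
apply: filterS2 (near_base q) (d_near q e1) => q' b qq'.
have fqq' := d_fin d_ge0 (ltW qq').
have h1 := d_triangle (base q) q q'; have h2 := d_triangle (base q) q' q.
have f1 := base_fin q; have f2 := base_fin q'; rewrite b in f2.
rewrite /level b; rewrite (d_sym q') in h2.
rewrite -(fineK f1) -(fineK f2) -(fineK fqq') -?EFinD ?lee_fin ?lte_fin in h1 h2 qq'.
by rewrite ltr_norml; lra.
Qed.

Definition slab (k : nat) (p : T) : set T := [set q | `|level q - k%:R| < 1 /\ base q = p].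

Lemma slab_nbhs k q : `|level q - k%:R| < 1 -> nbhs q (slab k (base q)).
Proof.
move=> qk; apply: filterI; last exact: near_base.
have e0 : 0 < 1 - `|level q - k%:R| by rewrite subr_gt0.
have /cvgrPdist_lt/(_ _ e0) := @level_continuous q.
apply: filterS => q' h /=.
have := ler_distD (level q) (level q') k%:R; rewrite (distrC (level q') (level q)).
by move: h; lra.
Qed.

(** Empty when [q] is outside the slab; the weight of [q] at this index is then 0. *)
Definition component (k : nat) (q : T) : set T := joined R (slab k (base q)) q.

Lemma component_eq k q q' : joined R (slab k (base q)) q q' -> component k q = component k q'.
Proof.
move=> qq'; have b : base q' = base q by have [g [_ _ <- h]] := qq'; exact: (h 1).2.
rewrite /component b; apply/seteqP; split=> x.
  by apply: joined_trans; exact: joined_sym.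
exact: joined_trans.
Qed.

Lemma near_component k q : `|level q - k%:R| < 1 ->
  \forall q' \near q, component k q' = component k q.
Proof.
move=> qk; apply: filterS (locally_joined (slab_nbhs qk)) => q' h.
exact/esym/component_eq.
Qed.

Lemma component_dist k q q' : `|level q - k%:R| < 1 -> `|level q' - k%:R| < 1 ->
  component k q = component k q' -> (d q q' < D%:E)%E.
Proof.
move=> qk q'k e; have : component k q' q'.
  by apply: joined_refl; split.
rewrite -e => -[g [cg g0 g1 gS]]; rewrite -g0 -g1.
apply: (@slab_bound (base q) (k%:R / 100)) => // t.
have [h b] := gS t; have := base_fin (g t); rewrite /level b in h *.
by move=> /fineK <-; rewrite !lte_fin; move: h; rewrite ltr_norml => /andP[]; lra.
Qed.

Local Notation V := (nat * {classic set T})%type.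

(** A partition of unity subordinate to the pieces of the slabs. *)
Definition coordinate (q : T) (v : V) : R :=
  if `[< v.2 = component v.1 q :> set T >] then plateau (level q - v.1%:R) else 0.

Definition floor_level q : nat := Num.truncn (level q).

Definition floor_edge q : {fset V} :=
  [fset (floor_level q, component (floor_level q) q : {classic set T});
        ((floor_level q).+1, component (floor_level q).+1 q : {classic set T})]%fset.

Lemma floor_level_itv q : (floor_level q)%:R <= level q < (floor_level q).+1%:R.
Proof. by rewrite /floor_level truncn_itv// level_ge0. Qed.

Lemma slab_floor k q : `|level q - k%:R| < 1 ->
  k = floor_level q \/ k = (floor_level q).+1.
Proof.
have /andP[h1 h2] := floor_level_itv q.
rewrite ltr_norml => /andP[h3 h4].
have : (k < (floor_level q).+2)%N by rewrite -(ltr_nat R) -natr1; move: h2 h3; lra.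
have : (floor_level q < k.+1)%N by rewrite -(ltr_nat R) -natr1; lra.
by rewrite !ltnS leq_eqVlt => /orP[/eqP|]; [left|]; lia.
Qed.

Lemma coordinate_neq0 q v : coordinate q v != 0 ->
  v.2 = component v.1 q :> set T /\ `|level q - v.1%:R| < 2 / 3.
Proof.
rewrite /coordinate; case: asboolP => [e h|_]; last by rewrite eqxx.
by split=> //; apply: plateau_gt0; rewrite lt_neqAle eq_sym h plateau_ge0.
Qed.

Lemma coordinate_simplex q : simplex_of (floor_edge q) (coordinate q).
Proof.
split=> [v|v|].
- by rewrite /coordinate; case: ifP => // _; exact: plateau_ge0.
- apply: contraNeq => /coordinate_neq0[]; case: v => k C /= -> hk.
  have {hk} : `|level q - k%:R| < 1 by apply: lt_trans hk _; lra.
  by rewrite /floor_edge !inE => /slab_floor[->|->]; rewrite eqxx ?orbT.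
- rewrite /floor_edge big_fsetU1 ?inE/=; last first.
    by rewrite xpair_eqE negb_and neq_ltn ltnSn.
  rewrite big_seq_fset1 /coordinate /= !asboolT//.
  have /andP[h1 h2] := floor_level_itv q.
  rewrite -natr1 in h2 *; rewrite opprD addrA plateauD//.
  by apply/andP; split; move: h1 h2; lra.
Qed.

Lemma floor_edge_face q : faces (complete_graph V) (floor_edge q).
Proof.
split; first by apply/fset0Pn; exists (floor_level q, component (floor_level q) q : {classic set T}); rewrite !inE eqxx.
by rewrite cardfs2; case: (_ != _).
Qed.

Definition reeb_map q : realization R (complete_graph V) :=
  @Realization R V (complete_graph V) (coordinate q)
    (ex_intro2 _ (fun s => simplex_of s (coordinate q)) _
      (floor_edge_face q) (coordinate_simplex q)).

(** Inside a slab, nearby points lie in the same piece. At its border, where the piece may change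
    abruptly, the plateau already vanishes. *)
Lemma coordinate_continuous (v : V) : continuous (coordinate^~ v).
Proof.
move=> q; case: v => k C.
have [qk|qk] := ltP `|level q - k%:R| 1.
  have E : \forall q' \near q, (if `[< C = component k q :> set T >]
      then plateau (level q' - k%:R) else 0) = coordinate q' (k, C).
    by apply: filterS (near_component qk) => q' e; rewrite /coordinate /= e.
  rewrite /prop_for /continuous_at -(nbhs_singleton E).
  apply: cvg_trans (near_eq_cvg E) _; case: ifP => _; last exact: cvg_cst.
  apply: (@cvg_comp _ _ _ (fun q' => level q' - k%:R) (@plateau R) _ (nbhs (level q - k%:R))).
    by apply: cvgB; [exact: level_continuous|exact: cvg_cst].
  exact: plateau_continuous.
have z q' : 2 / 3 <= `|level q' - k%:R| -> coordinate q' (k, C) = 0.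
  by move=> h; rewrite /coordinate /= plateau_eq0// if_same.
have E : \forall q' \near q, 0 = coordinate q' (k, C).
  have e0 : 0 < 1 / 3 :> R by lra.
  have /cvgrPdist_lt/(_ _ e0) := @level_continuous q.
  apply: filterS => q' h; rewrite z//.
  have := ler_distD (level q') (level q) k%:R; move: h qk; lra.
rewrite /prop_for /continuous_at -(nbhs_singleton E).
by apply: cvg_trans (near_eq_cvg E) _; exact: cvg_cst.
Qed.

Lemma reeb_continuous : continuous reeb_map.
Proof.
move=> q; apply: (@continuous_to_realization R V _ T reeb_map q (floor_edge q)); last first.
- by move=> v; exact: coordinate_continuous.
- have near_v k : \forall q' \near q, `|level q - k%:R| < 1 -> component k q' = component k q.
    have [qk|qk] := ltP `|level q - k%:R| 1; last exact: nearW.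
    by apply: filterS (near_component qk).
  (* 1/3 is the margin between the support radius 2/3 of the plateau and the half-width 1 of a slab:
     a vertex with nonzero weight at [q'] belongs to [floor_edge q]. *)
  have e0 : 0 < 1 / 3 :> R by lra.
  have /cvgrPdist_lt/(_ _ e0) nl := @level_continuous q.
  apply: filterS3 nl (near_v (floor_level q)) (near_v (floor_level q).+1) => q' hl h1 h2.
  have [c0 _ c1] := coordinate_simplex q'.
  have supp v : v \notin floor_edge q -> coordinate q' v = 0.
    apply: contraNeq => /coordinate_neq0[]; case: v => k C /= -> hk.
    have qk : `|level q - k%:R| < 1.
      by have := ler_distD (level q') (level q) k%:R; move: hl hk; lra.
    rewrite /floor_edge !inE; have [kE|kE] := slab_floor qk.
      by rewrite kE in qk *; rewrite (h1 qk) eqxx.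
    by rewrite kE in qk *; rewrite (h2 qk) eqxx orbT.
  by apply: simplex_of_change (coordinate_simplex q') _.
- exact: floor_edge_face.
Qed.

(** Points with the same image share a nonzero coordinate, hence a piece of a slab, and a path
    inside this piece joins them. *)
Lemma reeb_fiber q q' : reeb_map q = reeb_map q' -> (d q q' < D%:E)%E.
Proof.
move=> /(congr1 (@barycentric R V (complete_graph V))) /= e.
have [v vq] : exists v, coordinate q v != 0.
  apply/not_existsP => z; have [_ _] := coordinate_simplex q.
  rewrite big1 => [/esym/eqP|v _]; first by rewrite oner_eq0.
  by apply/eqP/negPn/negP; exact: z.
have vq' : coordinate q' v != 0 by rewrite -e.
have [e1 h1] := coordinate_neq0 vq; have [e2 h2] := coordinate_neq0 vq'.
have lt1 : 2 / 3 < 1 :> R by lra.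
apply: (@component_dist v.1); rewrite -?e1 -?e2//.
  exact: lt_trans h1 lt1.
exact: lt_trans h2 lt1.
Qed.

Lemma reeb_width : (UW d 1 [set: T] <= D%:E)%E.
Proof.
apply: ge_ereal_inf; exists (ereal_sup [set diam d (setT `&` reeb_map @^-1` [set y]) | y in setT]).
  exists V, (complete_graph V), reeb_map; split=> //.
  - by move=> s [].
  - exact: continuous_subspaceT reeb_continuous.
apply: ge_ereal_sup => _ [y _ <-]; apply: ge_ereal_sup => _ [q [q' [[_ /= qy] [_ /= q'y] ->]]].
by apply/ltW/reeb_fiber; rewrite qy q'y.
Qed.

End reeb.

Theorem theorem1p3 (R : realType) (n : nat) (M : riemannian_manifold R n)
    (M_closed : compact [set: M]) (beta : nat)
    (H1_rank : homology_rank (R := R) 'F_2 M 1 beta)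
    (unit_ball_width : forall p : M,
      (UW (@rdist R n M) 1 (unit_ball p) < (1 / 15)%:E)%E) :
  (UW (@rdist R n M) 1 [set: M] < (beta%:R + 1)%:E)%E.
Proof.
have dn (x : M) (e : R) : 0 < e -> \forall y \near x, (rdist x y < e%:E)%E.
  move=> e0; apply: filterS (@local_paths R n M x setT e (@filterT _ _ _) e0) => y [h _].
  exact: h.
have dp (x y : M) (r : \bar R) : (rdist x y < r)%E -> exists g : R -> M,
    [/\ continuous g, g 0 = x, g 1 = y & forall t, (rdist x (g t) + rdist (g t) y < r)%E].
  exact: rdist_path.
(* [reeb_width] gives a weak inequality only; the factor 9/10 makes it strict. *)
apply: (@le_lt_trans _ _ (((beta%:R + 1) * (9 / 10))%:E : \bar R)); last first.
  rewrite lte_fin; have : 0 <= beta%:R :> R by exact: ler0n.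
  lra.
apply: (@reeb_width R M (@rdist R n M)) => //.
- exact: rdist_ge0.
- exact: rdist_sym.
- exact: rdist_triangle.
- move=> x U xU; apply: filterS (local_paths xU ltr01) => y [_ h]; exact: h.
- by move=> p r g cg hg; apply: (@slab_diam R M (@rdist R n M) _ _ _ dn dp M_closed _ 'F_2 beta _ p r);
    [exact: rdist_ge0|exact: rdist_sym|exact: rdist_triangle|exact: unit_ball_width|exact: H1_rank|exact: cg|exact: hg].
Qed.
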